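(* Let $X$ be a separable stable Banach space. Then there exist a separable reflexive Banach space $R$ and a map $x\mapsto T_x$ from $X$ onto a subgroup $G$ of the group $\mathcal{U}$ of all (linear, surjective) isometries of $R$ such that, when $\mathcal{U}$ is endowed with the strong operator topology (the topology of pointwise convergence on $R$ in norm): $G$ is closed in $\mathcal{U}$; the map $x\mapsto T_x$ is a group isomorphism from $(X,+)$ onto $G$, that is, it is bijective with $T_{x+y}=T_x\circ T_y$ and $(T_x)^{-1}=T_{-x}$ for all $x,y\in X$; and this map is a homeomorphism from $X$ with its norm topology onto $G$ with the strong operator topology.
   Context: Banach spaces are real. Let $X$ be a separable Banach space. A sequence $(x_n)\subset X$ is called type determining if $\lim_{n\to\infty}\|x+x_n\|$ exists for every $x\in X$. The space $X$ is called stable if whenever $(x_n)$ and $(y_n)$ are type determining sequences in $X$, then $\lim_{n\to\infty}\lim_{m\to\infty}\|x_n+y_m\|=\lim_{m\to\infty}\lim_{n\to\infty}\|x_n+y_m\|$. *)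

(* Defs.v *)
From HB Require Import structures.
From mathcomp Require Import all_boot all_order all_algebra.
From mathcomp Require Import all_classical all_reals all_analysis.
Set Implicit Arguments.
Unset Strict Implicit.
Unset Printing Implicit Defensive.
Import Order.TTheory GRing.Theory Num.Theory.
Import numFieldNormedType.Exports.
Local Open Scope classical_set_scope.
Local Open Scope ring_scope.

Definition separable_space (T : topologicalType) : Prop :=
  exists2 D : set T, countable D & dense D.

Section Stability.
Context {R : realType} (X : normedModType R).

Definition type_determining (x_ : nat -> X) : Prop :=
  forall x : X, cvg (`|x + x_ n| @[n --> \oo]).

(* The inner limits exist because x_ and y_ are type determining; the existence
   of the outer ones is part of the asserted equality. *)
Definition stable_space : Prop :=
  forall x_ y_ : nat -> X, type_determining x_ -> type_determining y_ ->
    [/\ cvg (lim (`|x_ n + y_ m| @[m --> \oo]) @[n --> \oo]),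
        cvg (lim (`|x_ n + y_ m| @[n --> \oo]) @[m --> \oo]) &
        lim (lim (`|x_ n + y_ m| @[m --> \oo]) @[n --> \oo]) =
        lim (lim (`|x_ n + y_ m| @[n --> \oo]) @[m --> \oo])].

End Stability.

Section Reflexivity.
Context {R : realType} (E : normedModType R).

Definition dual : set (E -> R) := [set f : E -> R | scalar f /\ continuous f].

Definition dual_norm (f : E -> R) : R :=
  sup [set `|f x| | x in [set x : E | `|x| <= 1]].

(* An element of the bidual is represented by a function on all of E -> R, of
   which only the values on the dual are constrained. *)
Definition bidual : set ((E -> R) -> R) :=
  [set phi |
    (forall (a : R) (f g : E -> R), dual f -> dual g ->
       phi (fun x => a * f x + g x) = a * phi f + phi g) /\
    (exists M : R, forall f : E -> R, dual f -> `|phi f| <= M * dual_norm f)].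

Definition reflexive_space : Prop :=
  forall phi, bidual phi -> exists x : E, forall f, dual f -> phi f = f x.

End Reflexivity.

Section IsometryGroup.
Context {R : realType} (E : normedModType R).

Definition linear_isometries : set {ptws E -> E} :=
  [set u | [/\ linear (u : E -> E), forall v, `|u v| = `|v| &
               set_surj [set: E] [set: E] u]].

(* As a set_type over {ptws E -> E}, it carries the topology induced by
   pointwise norm convergence, i.e. the strong operator topology. *)
Definition isometry_group : Type := set_type linear_isometries.

HB.instance Definition _ := Topological.on isometry_group.

Definition isometry_fun (u : isometry_group) : E -> E := \val u.

Lemma isometryP (u : isometry_group) :
  [/\ linear (isometry_fun u), forall v, `|isometry_fun u v| = `|v| &
      set_surj [set: E] [set: E] (isometry_fun u)].
Proof. exact: set_mem (valP u). Qed.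

Lemma isometry_id_subproof : (idfun : {ptws E -> E}) \in linear_isometries.
Proof. by apply/mem_set; split => // v _; exists v. Qed.

Lemma isometry_comp_subproof (u w : isometry_group) :
  (isometry_fun u \o isometry_fun w : {ptws E -> E}) \in linear_isometries.
Proof.
have [ul un us] := isometryP u; have [wl wn ws] := isometryP w.
apply/mem_set; split => [a x y|v|v _] /=; first by rewrite wl ul.
  by rewrite un wn.
have [y _ <-] := us v I; have [z _ <-] := ws y I.
by exists z.
Qed.

Lemma isometry_inj (u : isometry_group) : injective (isometry_fun u).
Proof.
have [ul un _] := isometryP u => x y uxy.
apply/eqP; rewrite -subr_eq0 -normr_eq0 -un addrC -scaleN1r ul uxy.
by rewrite scaleN1r addNr normr0.
Qed.

Lemma isometry_inv_ex (u : isometry_group) :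
  exists w : isometry_group, cancel (isometry_fun u) (isometry_fun w).
Proof.
have [ul un us] := isometryP u.
have /choice[g gK] v : exists z, isometry_fun u z = v.
  by have [z _ <-] := us v I; exists z.
have gu : cancel (isometry_fun u) g by move=> x; apply: isometry_inj (gK _).
suff gP : (g : {ptws E -> E}) \in linear_isometries.
  by exists (SigSub gP : isometry_group).
apply/mem_set; split => [a x y|v|v _].
- by apply: (@isometry_inj u); rewrite ul !gK.
- by rewrite -[in RHS](gK v) un.
- by exists (isometry_fun u v).
Qed.

Definition isometry_one : isometry_group := SigSub isometry_id_subproof.
Definition isometry_mul (u w : isometry_group) : isometry_group :=
  SigSub (isometry_comp_subproof u w).
Definition isometry_inv (u : isometry_group) : isometry_group :=
  projT1 (cid (isometry_inv_ex u)).

Lemma isometry_group_ext (u w : isometry_group) :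
  isometry_fun u =1 isometry_fun w -> u = w.
Proof. by move=> uw; apply/val_inj/funext. Qed.

Lemma isometry_mulA : associative isometry_mul.
Proof. by move=> u v w; exact: isometry_group_ext. Qed.

Lemma isometry_mul1 : left_id isometry_one isometry_mul.
Proof. by move=> u; exact: isometry_group_ext. Qed.

Lemma isometry_mul1r : right_id isometry_one isometry_mul.
Proof. by move=> u; exact: isometry_group_ext. Qed.

Lemma isometry_mulV : left_inverse isometry_one isometry_inv isometry_mul.
Proof.
move=> u; apply: isometry_group_ext => x.
by rewrite /isometry_fun /= /isometry_inv; case: cid.
Qed.

Lemma isometry_mulrV : right_inverse isometry_one isometry_inv isometry_mul.
Proof.
move=> u; have uVV := isometry_mulV (isometry_inv u).
rewrite -[LHS]isometry_mul1 -uVV -isometry_mulA.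
by rewrite [in isometry_mul (isometry_inv u) _]isometry_mulA isometry_mulV isometry_mul1.
Qed.

HB.instance Definition _ := isGroup.Build isometry_group
  isometry_mulA isometry_mul1 isometry_mul1r isometry_mulV isometry_mulrV.

End IsometryGroup.

Definition homeomorphism_onto (S T : topologicalType) (B : set T)
    (f : S -> T) : Prop :=
  [/\ set_bij [set: S] B f, continuous f &
      exists2 g : T -> S, cancel f g & {within B, continuous g}].

(* Main.v *)
From HB Require Import structures.
Require Import Defs.
From mathcomp Require Import all_boot all_order all_algebra.
From mathcomp Require Import all_classical all_reals all_analysis.
From mathcomp Require Import ring lra.
Set Implicit Arguments.
Unset Strict Implicit.
Unset Printing Implicit Defensive.
Import Order.TTheory GRing.Theory Num.Theory.
Import numFieldNormedType.Exports.
Local Open Scope classical_set_scope.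
Local Open Scope ring_scope.

(** The space X acts on functions on X by translations, hence on the closed span of
  the translates of ker 0, the function t |-> (1 + |t|)^-1, for any translation
  invariant norm. The point is to find a norm for which this span is reflexive and
  the orbit of ker 0 still has the topology of X.

  The translates of ker 0 are the functions ker a, where ker x y is
  (1 + |x + y|)^-1. Stability of X means that the iterated limits of this kernel
  can be interchanged (stable_double_limits), which is Grothendieck's criterion for
  the orbit to be relatively weakly compact for the supremum norm. Then so is its
  absolutely convex hull W, by the theorem of Krein, proved here as an interchange
  of limits along finitely supported measures (double_limits_fmeas); it rests on a
  dominated convergence theorem for positive functionals
  (dominated_convergence_ultra).

  The norm is the one of Davis, Figiel, Johnson and Pelczynski: an l2-sum of norms
  K n interpolating between the gauge of W and the supremum norm, all invariant
  under translations. A ball for this norm is, up to arbitrarily small uniform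
  errors, contained in multiples of W, so the interchange of limits shows that a
  convex set of the ball converging pointwise contains uniform approximations of
  its limit (pointwise_to_uniform); a gliding hump in the l2-sum turns these into
  approximations in norm (convex_sup_to_Nle). With Goldstine's theorem, this gives
  reflexivity (dfjp_reflexive).

  On the orbit, the interpolation norm is controlled by the supremum norm
  (Nle_comb), so translations are continuous in the strong operator topology
  (translate_uniform). Conversely the distance of ker a to ker b in this norm
  controls |a - b| (translate_base_dist): this gives the continuity of the inverse
  map, and, X being complete, the closedness of the group (closed_translations). *)

(** * Limits along ultrafilters *)

Definition bounded_func (R : realType) (S : Type) (h : S -> R) : Prop :=
  exists C : R, forall s, `|h s| <= C.

Definition ulim (R : realType) (S : Type) (p : set_system S) (h : S -> R) : R :=
  lim (h @ p).

Lemma ultra_fmap (S T : Type) (f : S -> T) (p : set_system S) :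
  UltraFilter p -> UltraFilter (f @ p).
Proof.
move=> pU; split; first exact: fmap_proper_filter.
move=> G GF pG; rewrite eqEsubset; split => // A GA.
have [//|nA] := in_ultra_setVsetC (f @^-1` A) pU.
have /filter_ex[x []//] : G (A `&` ~` A) by apply: filterI => //; exact: pG.
Qed.

Lemma near_ex2 (S : Type) (p : set_system S) {pF : ProperFilter p} (A B : set S) :
  p A -> p B -> exists s, A s /\ B s.
Proof. by move=> pA pB; exact: filter_ex (filterI pA pB). Qed.

Section Ultralimit.
Context {R : realType} {S : Type} (p : set_system S) {pU : UltraFilter p}.
Implicit Types (h g : S -> R) (c e : R).

Lemma ulim_cvg h : bounded_func h -> h s @[s --> p] --> ulim p h.
Proof.
move=> [C hC]; have fU := ultra_fmap h pU.
suff [l [_ hl]] : `[- C, C]%classic `&` [set l | h @ p --> l] !=set0.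
  by apply/cvg_ex; exists l.
have := @segment_compact R (- C) C; rewrite compact_ultra; apply => //.
by apply: nearW => s /=; rewrite in_itv/= -ler_norml.
Qed.

Lemma ulim_unique h l : h s @[s --> p] --> l -> ulim p h = l.
Proof. by move=> hl; apply/cvg_lim. Qed.

Lemma ulim_cst c : ulim p (fun=> c) = c.
Proof. by apply: ulim_unique; exact: cvg_cst. Qed.

Lemma ulimD h g : bounded_func h -> bounded_func g ->
  ulim p (fun s => h s + g s) = ulim p h + ulim p g.
Proof. by move=> hb gb; apply: ulim_unique; apply: cvgD; exact: ulim_cvg. Qed.

Lemma ulimB h g : bounded_func h -> bounded_func g ->
  ulim p (fun s => h s - g s) = ulim p h - ulim p g.
Proof. by move=> hb gb; apply: ulim_unique; apply: cvgB; exact: ulim_cvg. Qed.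

Lemma ulimZ c h : bounded_func h -> ulim p (fun s => c * h s) = c * ulim p h.
Proof. by move=> hb; apply: ulim_unique; apply: cvgM; [exact: cvg_cst|exact: ulim_cvg]. Qed.

Lemma ulim_norm h : bounded_func h -> ulim p (fun s => `|h s|) = `|ulim p h|.
Proof. by move=> hb; apply: ulim_unique; apply: cvg_norm; exact: ulim_cvg. Qed.

Lemma ulim_le_near h g : bounded_func h -> bounded_func g ->
  (\forall s \near p, h s <= g s) -> ulim p h <= ulim p g.
Proof. 
move=> hb gb hg; rewrite -subr_ge0.
apply: (@cvgr_to_ge _ p _ R (fun s => g s - h s)).
  by apply: cvgB; exact: ulim_cvg.
by apply: filterS hg => s; rewrite subr_ge0. Qed.

Lemma ulim_le h g : bounded_func h -> bounded_func g ->
  (forall s, h s <= g s) -> ulim p h <= ulim p g.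
Proof. by move=> hb gb hg; apply: ulim_le_near => //; exact: nearW. Qed.

Lemma ulim_near h e : bounded_func h -> 0 < e ->
  \forall s \near p, `|h s - ulim p h| < e.
Proof.
move=> hb e0; have /cvgrPdist_lt/(_ _ e0) := ulim_cvg hb.
by apply: filterS => s; rewrite distrC.
Qed.

Lemma ulim_dist h g e : bounded_func h -> bounded_func g ->
  (\forall s \near p, `|h s - g s| <= e) -> `|ulim p h - ulim p g| <= e.
Proof.
move=> hb gb hg; rewrite -ulimB// -ulim_norm//; last first.
  have [[C hC] [D gD]] := (hb, gb).
  by exists (C + D) => s; rewrite (le_trans (ler_normB _ _))// lerD.
rewrite -[leRHS]ulim_cst; apply: ulim_le_near => //.
  have [[C hC] [D gD]] := (hb, gb).
  by exists (C + D) => s; rewrite normr_id (le_trans (ler_normB _ _))// lerD.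
by exists `|e|.
Qed.

Lemma ulim_bounded h e : (forall s, `|h s| <= e) -> `|ulim p h| <= e.
Proof.
move=> he; have hb : bounded_func h by exists e.
rewrite -ulim_norm// -[leRHS]ulim_cst; apply: ulim_le => //.
  by exists e => s; rewrite normr_id.
by exists `|e|.
Qed.

Lemma ulim_sum (I : Type) (l : seq I) (c : I -> R) (h : I -> S -> R) :
  (forall i, bounded_func (h i)) ->
  ulim p (fun s => \sum_(i <- l) c i * h i s) = \sum_(i <- l) c i * ulim p (h i).
Proof.
move=> hb; apply: ulim_unique.
elim: l => [|i l IHl].
  by under eq_fun do rewrite big_nil; rewrite big_nil; exact: cvg_cst.
under eq_fun do rewrite big_cons.
by rewrite big_cons; apply: cvgD => //; apply: cvgM; [exact: cvg_cst|exact: ulim_cvg].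
Qed.

End Ultralimit.
Arguments ulim_cvg {R S} p {pU}.
Arguments ulim_cst {R S} p {pU}.

Lemma ulim_fmap (R : realType) (S T : Type) (f : S -> T) (p : set_system S)
  (h : T -> R) : ulim (f @ p) h = ulim p (h \o f).
Proof. by []. Qed.

(** Grothendieck's double limit condition. Ultrafilters in place of sequences make
  all the limits exist when k is bounded. *)
Definition double_limits (R : realType) (S T : Type) (k : S -> T -> R) : Prop :=
  forall (p : set_system S) (q : set_system T),
    UltraFilter p -> UltraFilter q ->
    ulim p (fun s => ulim q (k s)) = ulim q (fun t => ulim p (k^~ t)).

Lemma near_sup_index (R : realType) (u : nat -> R) (B e : R) :
  (forall n, u n <= B) -> 0 < e -> exists N, forall n, u n <= u N + e.
Proof.
move=> uB e0.
have su : has_sup (range u).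
  by split; [exists (u 0%N), 0%N|exists B => _ [n _ <-]].
have [_ [N _ <-] hN] := sup_adherent e0 su.
exists N => n; have : u n <= sup (range u) by apply: sup_upper_bound => //; exists n.
lra.
Qed.

Lemma ultra_extend (S : Type) (D : nat -> set S) :
  (forall n, D n !=set0) -> (forall m n, (m <= n)%N -> D n `<=` D m) ->
  exists2 q : set_system S, UltraFilter q & forall n, q (D n).
Proof.
move=> D0 Dm.
have FF : ProperFilter (filter_from setT D).
  apply: filter_from_proper; last by move=> n _; exact: D0.
  apply: filter_from_filter; first by exists 0%N.
  move=> i j _ _; exists (maxn i j) => // s Ds.
  by split; apply: Dm Ds; rewrite ?leq_maxl ?leq_maxr.
have [q [qU Fq]] := ultraFilterLemma FF.
by exists q => // n; apply: Fq; exists n.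
Qed.

(** * Dominated convergence for positive functionals *)

Section DominatedConvergence.
Context {R : realType} {S : Type} (L : (S -> R) -> R) (M B : R).
Hypothesis L_le : forall h h', bounded_func h -> bounded_func h' ->
  (forall s, h s <= h' s) -> L h <= L h'.
Hypothesis LD : forall h h', bounded_func h -> bounded_func h' ->
  L (fun s => h s + h' s) = L h + L h'.
Hypothesis L_cst : forall c : R, 0 <= c -> L (fun=> c) <= c * M.
Variable g : nat -> S -> R.
Hypothesis g_ge0 : forall n s, 0 <= g n s.
Hypothesis g_le : forall n s, g n s <= B.
Hypothesis g_cvg : forall q : set_system S, UltraFilter q ->
  forall e : R, 0 < e -> exists N, forall n, (N <= n)%N -> ulim q (g n) < e.

Let gmax m N s := \big[Num.max/0]_(m <= j < N) g j s.

Let gmax_leP m N s (c : R) : 0 <= c ->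
  (forall j, (m <= j < N)%N -> g j s <= c) -> gmax m N s <= c.
Proof.
move=> c0 gc; rewrite /gmax big_nat.
by apply: (big_ind (fun x => x <= c)) => // x y xc yc; rewrite ge_max xc yc.
Qed.

Let gmax_ge m N s j : (m <= j < N)%N -> g j s <= gmax m N s.
Proof. by move=> jmN; apply: le_bigmax_seq => //; rewrite mem_index_iota. Qed.

Let gmax_ge0 m N s : 0 <= gmax m N s.
Proof. exact: bigmax_ge_id. Qed.

Let B0 (s : S) : 0 <= B. Proof. exact: le_trans (g_le 0%N s). Qed.

Let gmax_le m N s : gmax m N s <= B.
Proof. by apply: gmax_leP => //; exact: B0. Qed.

Let bounded_gmax m N : bounded_func (gmax m N).
Proof. by exists B => s; rewrite ger0_norm. Qed.

Let gmax_mono m m' N N' s : (m' <= m)%N -> (N <= N')%N -> gmax m N s <= gmax m' N' s.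
Proof.
move=> mm NN; apply: gmax_leP => // j /andP[mj jN]; apply: gmax_ge.
by rewrite (leq_trans mm mj) (leq_trans jN NN).
Qed.

(** Arzela's argument. The maximum pm n of a block of the functions g j, n <= j, is
  chosen so that L is almost the same on longer blocks, hence L (g n) is at most
  L (pm n) up to a small error. Replacing the functions pm n by their decreasing
  minima qm n loses little for the same reason, and the minima tend to 0
  uniformly: otherwise the nested nonempty sets where qm n exceeds some eta would
  belong to one ultrafilter q, along which all the functions of a late block are
  eventually smaller than eta. *)
Lemma dominated_convergence_ultra (e : R) : 0 < e ->
  exists N, forall n, (N <= n)%N -> L (g n) < e.
Proof.
move=> e0.
have [[s0]|S0] := pselect (inhabited S); last first.
  have bS (h : S -> R) : bounded_func h by exists 0 => s; case: S0; exact: (inhabits s).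
  have L0 (h : S -> R) : L h <= 0.
    rewrite -[leRHS](mul0r M) (le_trans _ (L_cst (lexx 0)))//.
    by apply: L_le => // s; case: S0; exact: (inhabits s).
  by exists 0%N => n _; exact: le_lt_trans (L0 _) e0.
have Bge0 := B0 s0.
have cb (c : R) : @bounded_func R S (fun=> c) by exists `|c|.
have M0 : 0 <= M.
  have : L (fun=> 0) + L (fun=> 0) = L (fun=> 0).
    by rewrite -LD//; congr L; apply/funext => s; rewrite addr0.
  move/eqP; rewrite -subr_eq0 addrK => /eqP L0.
  have := L_cst (@ler01 R); rewrite mul1r; apply: le_trans.
  by rewrite -L0; apply: L_le.
pose d m := e / 6 / 2 ^+ m.
have d0 m : 0 < d m by rewrite !divr_gt0// exprn_gt0.
have Nex m : exists N, forall N', L (gmax m N') <= L (gmax m N) + d m.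
  apply: (@near_sup_index _ _ (B * M)) => // N.
  by apply: le_trans (L_cst Bge0); apply: L_le.
have /choice[N HN] := Nex.
pose pm m := gmax m (N m).
pose qm := fix qm m s := if m is m'.+1 then Num.min (qm m' s) (pm m s) else pm 0%N s.
have qm_le m s : qm m s <= pm m s.
  by case: m => [|m] //=; rewrite ge_min lexx orbT.
have qm_ge0 m s : 0 <= qm m s.
  by elim: m => [|m IHm] /=; rewrite ?gmax_ge0// le_min IHm gmax_ge0.
have bq m : bounded_func (qm m).
  by exists B => s; rewrite ger0_norm//; exact: le_trans (qm_le m s) (gmax_le _ _ _).
have bp m : bounded_func (pm m) by exact: bounded_gmax.
have qm_mono m n s : (m <= n)%N -> qm n s <= qm m s.
  elim: n => [|n IHn]; first by rewrite leqn0 => /eqP->.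
  rewrite leq_eqVlt => /predU1P[->//|mn].
  by apply: le_trans (IHn mn); rewrite /= ge_min lexx.
(* the loss L (pm m) - L (qm m) grows by at most d m at each step *)
have Lpq m : L (pm m) - L (qm m) <= e / 3 - 2 * d m.
  elim: m => [|m IHm]; first by rewrite /= subrr /d expr0 divr1; lra.
  pose mx s := Num.max (qm m s) (pm m.+1 s).
  have mxle s : mx s <= gmax m (maxn (N m) (N m.+1)) s.
    rewrite /mx ge_max (le_trans (qm_le m s)) /=; last by apply: gmax_mono; rewrite ?leq_maxl.
    by apply: gmax_mono; rewrite ?leq_maxr.
  have bmx : bounded_func mx.
    exists B => s; rewrite ger0_norm ?le_max ?qm_ge0//.
    exact: le_trans (mxle s) (gmax_le _ _ _).
  have eqL : L (qm m.+1) + L mx = L (qm m) + L (pm m.+1).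
    rewrite -!LD//; congr L; apply/funext => s /=.
    by rewrite /mx addr_min_max.
  have Lmx : L mx <= L (pm m) + d m by apply: le_trans (HN _ _); apply: L_le.
  have dS : d m = 2 * d m.+1.
    rewrite /d exprS; field.
    by rewrite expf_neq0//.
  lra.
have [m0 Hm0] : exists m, forall s, qm m s <= e / (6 * (M + 1)).
  apply: contrapT => /forallNP H.
  set eta := e / (6 * (M + 1)) in H.
  have eta0 : 0 < eta by rewrite divr_gt0// mulr_gt0// ltr_wpDl.
  have [|m n mn s|q qU Hq] := @ultra_extend S (fun m => [set s | eta < qm m s]).
  - move=> m; have /existsNP[s /negP] := H m.
    by rewrite -ltNge => ?; exists s.
  - by move=> /= /lt_le_trans; apply; exact: qm_mono.
  have eta20 : 0 < eta / 2 by rewrite divr_gt0.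
  have [m1 Hm1] := g_cvg qU eta20.
  have small n : (m1 <= n)%N -> \forall s \near q, g n s < eta.
    move=> m1n; have := @ulim_near R S q qU (g n) _ _ eta20.
    have bg : bounded_func (g n) by exists B => s; rewrite ger0_norm.
    move=> /(_ bg); apply: filterS => s; rewrite ltr_norml => /andP[_].
    by have := Hm1 n m1n; lra.
  have : \forall s \near q, pm m1 s < eta.
    have : \forall s \near q, forall j, (j < N m1)%N -> (m1 <= j)%N -> g j s < eta.
      elim: (N m1) => [|n IHn]; first exact: nearW.
      have [nm|mn] := leqP m1 n; last first.
        apply: filterS IHn => s sn j; rewrite ltnS leq_eqVlt => /predU1P[->|/sn//].
        by rewrite leqNgt mn.
      apply: filterS (filterI (small n nm) IHn) => s [sn IH] j.
      by rewrite ltnS leq_eqVlt => /predU1P[->//|/IH].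
    apply: filterS => s sj; rewrite /pm /gmax big_nat.
    apply: (big_ind (fun x => x < eta)) => // [x y xe ye|j /andP[? ?]].
      by rewrite gt_max xe ye.
    exact: sj.
  have := Hq m1 => /filterI /[apply] /filter_ex[s [/= qs ps]].
  by have := lt_le_trans qs (qm_le m1 s); rewrite ltNge (ltW ps).
exists m0 => n m0n.
have Lg : L (g n) <= L (pm n) + d n.
  apply: le_trans (HN n n.+1); apply: L_le => //.
    by exists B => s; rewrite ger0_norm.
  by move=> s; apply: gmax_ge; rewrite leqnn ltnSn.
have Lq : L (qm n) <= e / 6.
  have c0 : 0 <= e / (6 * (M + 1)) by rewrite divr_ge0 ?ltW// mulr_gt0// ltr_wpDl.
  apply: (@le_trans _ _ (e / (6 * (M + 1)) * M)).
    apply: le_trans (L_cst c0); apply: L_le => // s.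
    exact: le_trans (qm_mono _ _ _ m0n) (Hm0 s).
  rewrite invfM mulrA -mulrA ger_pMr ?divr_gt0//.
  by rewrite mulrC ler_pdivrMr ?mul1r ?lerDl// ltr_wpDl.
have := Lpq n; have := d0 n; lra.
Qed.

End DominatedConvergence.

(** * Finitely supported signed measures *)

Section FiniteMeasures.
Context {R : realType} {T : Type}.
Implicit Types (mu nu : seq (R * T)) (h : T -> R) (c : R).

Definition mass mu : R := \sum_(a <- mu) `|a.1|.
Definition meas_int mu h : R := \sum_(a <- mu) a.1 * h a.2.
Definition scalem c mu : seq (R * T) := [seq (c * a.1, a.2) | a <- mu].

Lemma mass_ge0 mu : 0 <= mass mu.
Proof. by apply: sumr_ge0 => a _. Qed.

Lemma mass_nil : mass [::] = 0. Proof. by rewrite /mass big_nil. Qed.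

Lemma mass_cat mu nu : mass (mu ++ nu) = mass mu + mass nu.
Proof. by rewrite /mass big_cat. Qed.

Lemma massZ c mu : mass (scalem c mu) = `|c| * mass mu.
Proof.
by rewrite /mass big_map mulr_sumr; apply: eq_bigr => a _; rewrite normrM.
Qed.

Lemma meas_int_nil h : meas_int [::] h = 0. Proof. by rewrite /meas_int big_nil. Qed.

Lemma meas_int_cat mu nu h : meas_int (mu ++ nu) h = meas_int mu h + meas_int nu h.
Proof. by rewrite /meas_int big_cat. Qed.

Lemma meas_intZ c mu h : meas_int (scalem c mu) h = c * meas_int mu h.
Proof.
by rewrite /meas_int big_map mulr_sumr; apply: eq_bigr => a _; rewrite mulrA.
Qed.

Lemma meas_intB mu h h' : meas_int mu (fun t => h t - h' t) = meas_int mu h - meas_int mu h'.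
Proof. by rewrite /meas_int -sumrB; apply: eq_bigr => a _; rewrite mulrBr. Qed.

Lemma meas_int_bound mu h c : (forall t, `|h t| <= c) -> `|meas_int mu h| <= mass mu * c.
Proof.
move=> hc; rewrite (le_trans (ler_norm_sum _ _ _))// mulr_suml ler_sum// => a _.
by rewrite normrM ler_wpM2l.
Qed.

(** The total variation measure, when no point is repeated in mu; dominated
  convergence needs a positive functional. *)
Definition absm mu : seq (R * T) := [seq (`|a.1|, a.2) | a <- mu].

Lemma mass_absm mu : mass (absm mu) = mass mu.
Proof. by rewrite /mass big_map; apply: eq_bigr => a _; rewrite normr_id. Qed.

Lemma meas_int_absm mu h : meas_int (absm mu) h = \sum_(a <- mu) `|a.1| * h a.2.
Proof. by rewrite /meas_int big_map. Qed.

Lemma meas_int_absm_le mu h h' : (forall t, h t <= h' t) ->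
  meas_int (absm mu) h <= meas_int (absm mu) h'.
Proof. by move=> hh; rewrite !meas_int_absm ler_sum// => a _; rewrite ler_wpM2l. Qed.

Lemma normr_meas_int mu h : `|meas_int mu h| <= meas_int (absm mu) (fun t => `|h t|).
Proof.
rewrite meas_int_absm (le_trans (ler_norm_sum _ _ _))// ler_sum// => a _.
by rewrite normrM.
Qed.

(** The bound on the mass makes bounded kernels on points bounded on measures. *)
Definition fmeas (C : R) := {mu : seq (R * T) | mass mu <= C}.

Definition to_fmeas C mu (muC : mass mu <= C) : fmeas C :=
  exist (fun nu => mass nu <= C) mu muC.

Lemma fmeas_bound C h c (mu : fmeas C) : 0 <= c -> (forall t, `|h t| <= c) ->
  `|meas_int (val mu) h| <= C * c.
Proof.
by move=> c0 hc; rewrite (le_trans (meas_int_bound _ hc))// ler_wpM2r// (valP mu).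
Qed.

Lemma fmeas_bounded C h : bounded_func h ->
  bounded_func (fun mu : fmeas C => meas_int (val mu) h).
Proof.
move=> [c hc]; exists (C * `|c|) => mu; apply: fmeas_bound => // t.
exact: le_trans (hc t) (ler_norm c).
Qed.

Lemma fmeas_absm_bounded C h : bounded_func h ->
  bounded_func (fun mu : fmeas C => meas_int (absm (val mu)) h).
Proof.
move=> [c hc]; exists (C * `|c|) => mu.
rewrite (le_trans (meas_int_bound _ (c := `|c|) _))// => [t|].
  exact: le_trans (hc t) (ler_norm c).
by rewrite mass_absm ler_wpM2r// (valP mu).
Qed.

End FiniteMeasures.
Arguments fmeas {R} T C.

(** * The double limit condition passes to measures *)

(** This makes pointwise convergence of the functions k s a condition on countably
  many points, so that sequences can replace ultrafilters. *)
Definition kernel_separable (R : realType) (S T : Type) (k : S -> T -> R) : Prop :=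
  exists d : nat -> T, forall t (e : R), 0 < e ->
    exists i, forall s, `|k s t - k s (d i)| <= e.

Definition kernel_bounded (R : realType) (S T : Type) (k : S -> T -> R) : Prop :=
  exists B : R, forall s t, `|k s t| <= B.

Definition kernel_meas (R : realType) (S T : Type) (k : S -> T -> R) (C : R)
  (s : S) (mu : fmeas T C) : R := meas_int (val mu) (k s).

Lemma ultra_not_small (R : realType) (u : nat -> R) (e : R) :
  ~ (exists N, forall n, (N <= n)%N -> u n < e) ->
  exists2 w : set_system nat, UltraFilter w &
    (forall N, w [set n | (N <= n)%N]) /\ w [set n | e <= u n].
Proof.
move=> /forallNP H.
have [N|m n mn i [/= ni ui]|w wU Hw] :=
    @ultra_extend nat (fun N => [set n | (N <= n)%N /\ e <= u n]).
- have /existsNP[n /not_implyP[Nn /negP]] := H N.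
  by rewrite -leNgt => ?; exists n.
- by split => //; exact: leq_trans ni.
exists w => //; split; last by apply: filterS (Hw 0%N) => n [].
by move=> N; apply: filterS (Hw N) => n [].
Qed.

(** Each of the sets of p imposing finitely many of the limits with precision
  1 / (n + 1) is nonempty; the points d i are enough, by uniform approximation. *)
Lemma ultra_seq (R : realType) (S T : Type) (k : S -> T -> R) (h : S -> R)
    (p : set_system S) :
  kernel_separable k -> kernel_bounded k -> bounded_func h -> UltraFilter p ->
  exists x : nat -> S, h (x n) @[n --> \oo] --> ulim p h /\
    forall t, k (x n) t @[n --> \oo] --> ulim p (k^~ t).
Proof.
move=> [d kd] [B kB] bh pU.
have bk t : bounded_func (k^~ t) by exists B.
have xex n : exists s, `|h s - ulim p h| < n.+1%:R^-1 /\
    forall i, (i <= n)%N -> `|k s (d i) - ulim p (k^~ (d i))| < n.+1%:R^-1.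
  have e0 : 0 < n.+1%:R^-1 :> R by rewrite invr_gt0.
  have H m : \forall s \near p,
      forall i, (i < m)%N -> `|k s (d i) - ulim p (k^~ (d i))| < n.+1%:R^-1.
    elim: m => [|m IHm]; first exact: nearW.
    apply: filterS (filterI IHm (ulim_near (bk (d m)) e0)) => s [IH sm] i.
    by rewrite ltnS leq_eqVlt => /predU1P[->//|/IH].
  have [s [sL sH]] := near_ex2 (ulim_near bh e0) (H n.+1).
  by exists s; split.
have /choice[x Hx] := xex.
exists x; split => [|t]; apply/cvgrPdist_lt => e e0.
  have [N _ HN] := near_infty_natSinv_lt (PosNum e0).
  by exists N => // n /HN; rewrite distrC; apply: lt_trans; exact: (Hx n).1.
have e4 : 0 < e / 4 by rewrite divr_gt0.
have [i Hi] := kd t _ e4; have [N _ HN] := near_infty_natSinv_lt (PosNum e4).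
have Hinf : `|ulim p (k^~ t) - ulim p (k^~ (d i))| <= e / 4.
  by apply: ulim_dist => //; exact: nearW.
exists (maxn N i) => // n; rewrite /= geq_max => /andP[Nn ni].
have := (Hx n).2 i ni; have /= := HN n Nn; have := Hi (x n); move: Hinf.
move: (n.+1%:R^-1 : R) => eta.
rewrite !ler_distl !ltr_distl => /andP[? ?] /andP[? ?] ? /andP[? ?].
by apply/andP; split; lra.
Qed.

Section Krein.
Context {R : realType} {S T : Type} (k : S -> T -> R) (C : R).
Hypothesis k_sep : kernel_separable k.
Hypothesis k_dl : double_limits k.

(** The half of the theorem of Krein and Grothendieck on convex hulls where only one
  variable is replaced by measures. The limit of k along p is the pointwise limit
  of a sequence k (x n); the double limit condition says that this convergence
  holds at every ultrafilter of T too, so dominated convergence applies to the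
  limit along q of the total variation measures. *)
Lemma double_limits_meas : kernel_bounded k -> double_limits (@kernel_meas R S T k C).
Proof.
move=> [B kB] p q pU qU.
have bk s : bounded_func (k s) by exists B.
have bk' t : bounded_func (k^~ t) by exists B.
pose kinf t := ulim p (k^~ t).
have kinfB t : `|kinf t| <= B by exact: ulim_bounded.
have bkinf : bounded_func kinf by exists B.
pose L h := ulim q (fun mu : fmeas T C => meas_int (val mu) h).
have -> : ulim q (fun t : fmeas T C => ulim p ((kernel_meas k (C:=C))^~ t)) = L kinf.
  congr lim; congr (_ @ q); apply/funext => mu.
  rewrite /kernel_meas /meas_int ulim_sum// => a; exact: bk'.
pose alpha := ulim p (fun s => L (k s)).
rewrite -[LHS]/alpha.
have bL : bounded_func (fun s => L (k s)).
  exists (C * `|B|) => s; apply: ulim_bounded => mu; apply: fmeas_bound => // t.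
  by apply: le_trans (kB _ _) _; exact: ler_norm.
have [x [xL xcvg]] := ultra_seq k_sep (ex_intro _ B kB) bL pU.
pose g n t := `|k (x n) t - kinf t|.
have bg n : bounded_func (g n).
  by exists (B + B) => t; rewrite normr_id (le_trans (ler_normB _ _))// lerD.
have gcvg (r : set_system T) : UltraFilter r -> forall e : R, 0 < e ->
    exists N, forall n, (N <= n)%N -> ulim r (g n) < e.
  move=> rU e e0; apply: contrapT => /ultra_not_small[w wU [winf we]].
  have xwU : UltraFilter (x @ w) := ultra_fmap x wU.
  have eqinf t : ulim (x @ w) (k^~ t) = kinf t.
    apply: ulim_unique; apply: cvg_trans (xcvg t).
    by move=> A [N _ NA]; exact: (@filterS _ w _ _ _ NA (winf N)).
  have := k_dl xwU rU.
  have -> : (fun t => ulim (x @ w) (k^~ t)) = kinf by apply/funext.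
  have bu : bounded_func (fun n => ulim r (k (x n))).
    by exists B => n; exact: ulim_bounded.
  rewrite ulim_fmap => eqdl.
  have [n [/= n1 n2]] := near_ex2 (ulim_near bu e0) we.
  move: n1; rewrite /= [X in _ - X]eqdl -ulimB// -ulim_norm ?leNgt; last first.
    by exists (B + B) => t; rewrite (le_trans (ler_normB _ _))// lerD.
  by rewrite ltNge n2.
pose La h := ulim q (fun mu : fmeas T C => meas_int (absm (val mu)) h).
have Ladist h h' : bounded_func h -> bounded_func h' ->
    `|L h - L h'| <= La (fun t => `|h t - h' t|).
  move=> hb hb'.
  have bd : bounded_func (fun t => h t - h' t).
    have [[D hD] [D' hD']] := (hb, hb').
    by exists (D + D') => t; rewrite (le_trans (ler_normB _ _))// lerD.
  rewrite /L -ulimB; [|exact: fmeas_bounded..].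
  under eq_fun do rewrite -meas_intB.
  rewrite -ulim_norm; last exact: fmeas_bounded.
  apply: ulim_le => [||mu]; last exact: normr_meas_int.
    have [D HD] := fmeas_bounded C bd.
    by exists D => mu; rewrite normr_id.
  apply: fmeas_absm_bounded; have [D hD] := bd.
  by exists D => t; rewrite normr_id.
have La_cvg : forall e : R, 0 < e -> exists N, forall n, (N <= n)%N -> La (g n) < e.
  move=> e; apply: (@dominated_convergence_ultra R T La C (B + B)) => //.
  - move=> h h' hb hb' hh; apply: ulim_le => [||mu]; last exact: meas_int_absm_le.
    + exact: fmeas_absm_bounded.
    + exact: fmeas_absm_bounded.
  - move=> h h' hb hb'; rewrite /La -ulimD; [|exact: fmeas_absm_bounded..].
    congr lim; congr (_ @ q); apply/funext => mu.
    by rewrite /meas_int -big_split; apply: eq_bigr => a _; rewrite mulrDr.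
  - move=> c c0; rewrite -[leRHS](ulim_cst q); apply: ulim_le => [||mu].
    + by apply: fmeas_absm_bounded; exists `|c|.
    + by exists `|c * C|.
    rewrite meas_int_absm -mulr_suml mulrC ler_wpM2l//; exact: (valP mu).
  - by move=> n t; exact: normr_ge0.
  - by move=> n t; rewrite /g (le_trans (ler_normB _ _))// lerD.
apply: cvg_unique (xL) _ => //; apply/cvgrPdist_lt => e e0.
have [N HN] := La_cvg _ e0; exists N => // n /= Nn.
by rewrite distrC (le_lt_trans (Ladist _ _ _ _) (HN n Nn)).
Qed.

End Krein.

Lemma double_limits_sym (R : realType) (S T : Type) (k : S -> T -> R) :
  double_limits k -> double_limits (fun t s => k s t).
Proof. by move=> H p q pU qU; rewrite (H q p). Qed.

(** The symmetry of the condition allows replacing both variables by measures, one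
  after the other: the second time, measures on T play the role of the points. *)
Lemma double_limits_fmeas (R : realType) (S T : Type) (k : S -> T -> R) (C D : R) :
  kernel_bounded k -> kernel_separable k ->
  kernel_separable (fun t s => k s t) -> double_limits k ->
  double_limits (fun (mu : fmeas S C) (nu : fmeas T D) =>
    meas_int (val mu) (fun s => meas_int (val nu) (k s))).
Proof.
move=> [B kB] ksep ksep' kdl.
have kB' : kernel_bounded (fun (nu : fmeas T D) s => kernel_meas k s nu).
  by exists (D * `|B|) => nu s; apply: fmeas_bound => // t; apply: le_trans (kB _ _) (ler_norm _).
have := double_limits_meas (C := D) ksep kdl (ex_intro _ B kB).
move=> /double_limits_sym/(double_limits_meas (C := C)) H.
apply: double_limits_sym; apply: H => //.
have [d Hd] := ksep'; exists d => s e e0.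
have eD : 0 < e / (`|D| + 1) by rewrite divr_gt0// ltr_wpDl.
have [i Hi] := Hd s _ eD; exists i => nu; rewrite /kernel_meas -meas_intB.
apply: le_trans (fmeas_bound nu (ltW eD) Hi) _.
rewrite mulrCA ler_piMr ?(ltW e0)// ler_pdivrMr ?ltr_wpDl// mul1r.
by rewrite (le_trans (ler_norm _)) ?lerDl.
Qed.

(** * The kernel of a stable space *)

Lemma separable_seq (T : topologicalType) : inhabited T -> separable_space T ->
  exists d : nat -> T, dense (range d).
Proof.
move=> [t0] [D Dc Dd]; have /countable_injP[f finj] := Dc.
have /choice[d Hd] n : exists t, forall s, D s -> f s = n -> t = s.
  have [[s [Ds fs]]|H] := pselect (exists s, D s /\ f s = n); last first.
    by exists t0 => s Ds fs; case: H; exists s.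
  by exists s => s' Ds' fs'; apply: finj; rewrite ?inE// fs fs'.
exists d => O O0 Oop; have [x [Ox Dx]] := Dd O O0 Oop.
by exists x; split => //; exists (f x) => //; rewrite (Hd _ x).
Qed.

Lemma dense_seq_norm (R : realType) (X : normedModType R) (d : nat -> X) :
  dense (range d) -> forall x (e : R), 0 < e -> exists i, `|x - d i| < e.
Proof.
move=> dd x e e0; have [||y [xy [i _ di]]] := dd (ball x e).
- by exists x; exact: ballxx.
- exact: ball_open.
by exists i; move: xy; rewrite -ball_normE /= di.
Qed.

Section StableKernel.
Context {R : realType} {X : normedModType R}.
Implicit Types (x y t : X).

(** Compared with the norm of x + y itself, this kernel is bounded, and it tends to
  0 along the unbounded sequences, about which stability says nothing. *)
Definition ker x y : R := (1 + `|x + y|)^-1.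

Lemma ker_den_gt0 x y : 0 < 1 + `|x + y|.
Proof. by rewrite ltr_pwDl. Qed.

Lemma ker_gt0 x y : 0 < ker x y.
Proof. by rewrite invr_gt0 ker_den_gt0. Qed.

Lemma ker_le1 x y : ker x y <= 1.
Proof. by rewrite invf_le1 ?ker_den_gt0// lerDl. Qed.

Lemma kerC x y : ker x y = ker y x.
Proof. by rewrite /ker (addrC x). Qed.

Lemma ker_norm x y : `|x + y| = (ker x y)^-1 - 1.
Proof. by rewrite /ker invrK addrAC subrr add0r. Qed.

Lemma ker_bounded : kernel_bounded ker.
Proof. by exists 1 => x y; rewrite gtr0_norm ?ker_gt0// ker_le1. Qed.

(** As a consequence, ker x y tends to 0 for all y as soon as it does for one y. *)
Lemma ker_harnack x y t : ker x y <= (1 + `|y - t|) * ker x t.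
Proof.
rewrite /ker ler_pdivlMr ?ker_den_gt0// mulrC ler_pdivrMr ?ker_den_gt0//.
have : `|x + t| <= `|x + y| + `|y - t|.
  have -> : x + t = (x + y) + (t - y) by rewrite (addrC t) addrA addrK.
  by rewrite (distrC y) ler_normD.
by have := normr_ge0 (x + y); have := normr_ge0 (y - t); nra.
Qed.

Lemma ker_lip x y t : `|ker x y - ker x t| <= `|y - t|.
Proof.
have H a b : ker x a - ker x b <= `|a - b|.
  have := ker_harnack x a b; have := ker_le1 x b; have := ker_gt0 x b.
  by have := normr_ge0 (a - b); nra.
by rewrite ler_norml H lerNl opprB distrC H.
Qed.

Lemma ker_separable : separable_space X -> kernel_separable ker.
Proof.
move=> Xsep; have [d /dense_seq_norm dd] := separable_seq (inhabits (0 : X)) Xsep.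
exists d => t e e0; have [i di] := dd t e e0.
by exists i => s; exact: le_trans (ker_lip _ _ _) (ltW di).
Qed.

Lemma bounded_ker x : bounded_func (ker x).
Proof. by have [B HB] := ker_bounded; exists B. Qed.

Lemma bounded_kerl y : bounded_func (ker^~ y).
Proof. by have [B HB] := ker_bounded; exists B. Qed.

Section UltrafilterType.
Variables (p : set_system X) (pU : UltraFilter p).

Lemma ulim_ker_ge0 t : 0 <= ulim p (ker^~ t).
Proof.
rewrite -(ulim_cst p 0); apply: ulim_le => [||x]; last exact: ltW (ker_gt0 _ _).
  by exists 0 => s; rewrite normr0.
exact: bounded_kerl.
Qed.

Lemma ulim_ker_le1 t : `|ulim p (ker^~ t)| <= 1.
Proof.
by apply: ulim_bounded => x; rewrite gtr0_norm ?ker_gt0// ker_le1.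
Qed.

Lemma ulim_ker_harnack y t :
  ulim p (ker^~ y) <= (1 + `|y - t|) * ulim p (ker^~ t).
Proof.
rewrite -ulimZ; last exact: bounded_kerl.
apply: ulim_le => [||x]; [exact: bounded_kerl| |exact: ker_harnack].
exists (1 + `|y - t|) => x; rewrite ger0_norm.
  by rewrite ler_piMr ?ker_le1// addr_ge0.
by rewrite mulr_ge0 ?addr_ge0// ltW// ker_gt0.
Qed.

Lemma ulim_ker_gt0 t : 0 < ulim p (ker^~ 0) -> 0 < ulim p (ker^~ t).
Proof.
move=> p0; have := ulim_ker_harnack 0 t.
move=> /(lt_le_trans p0); rewrite pmulr_rgt0// ltr_pwDl//.
Qed.

Lemma ulim_ker_eq0 t : ulim p (ker^~ 0) = 0 -> ulim p (ker^~ t) = 0.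
Proof.
move=> p0; have := ulim_ker_harnack t 0; rewrite p0 mulr0 => le0.
by apply/eqP; rewrite eq_le le0 ulim_ker_ge0.
Qed.

End UltrafilterType.

Lemma ulim_kerE (q : set_system X) x : ulim q (ker x) = ulim q (ker^~ x).
Proof. by congr (ulim q); apply/funext => y; exact: kerC. Qed.

(** When the norm tends to infinity along p, either it does along q too, or q lives
  on a ball, where ker x y is uniformly comparable to ker x 0. *)
Lemma double_ulim0 (p q : set_system X) : UltraFilter p -> UltraFilter q ->
  ulim p (ker^~ 0) = 0 ->
  ulim p (fun x => ulim q (ker x)) = 0 /\ ulim q (fun y => ulim p (ker^~ y)) = 0.
Proof.
move=> pU qU p0.
have bq : bounded_func (fun x => ulim q (ker x)).
  by exists 1 => x; rewrite ulim_kerE ulim_ker_le1.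
split; last first.
  have -> : (fun y => ulim p (ker^~ y)) = fun=> 0 by apply/funext => y; exact: ulim_ker_eq0.
  exact: ulim_cst.
have [q0|q0] := eqVneq (ulim q (ker^~ 0)) 0.
  have -> : (fun x => ulim q (ker x)) = fun=> 0.
    by apply/funext => x; rewrite ulim_kerE ulim_ker_eq0.
  exact: ulim_cst.
have {}q0 : 0 < ulim q (ker^~ 0) by rewrite lt_def q0 ulim_ker_ge0.
set b := ulim q (ker^~ 0) in q0.
apply/eqP; rewrite eq_le; apply/andP; split; last first.
  rewrite -(ulim_cst p 0); apply: ulim_le => // [|x].
    by exists 0 => s; rewrite normr0.
  by rewrite ulim_kerE ulim_ker_ge0.
(* q lives on the ball of points where ker y 0 >= b / 2 *)
have b2 : 0 < b / 2 by rewrite divr_gt0.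
have Hq : \forall y \near q, b / 2 <= ker y 0.
  apply: filterS (ulim_near (bounded_kerl 0) b2) => y.
  by rewrite ltr_distl -/b => /andP[+ _]; lra.
have -> : 0 = ulim p (fun x => (2 / b) * ker x 0).
  by rewrite ulimZ ?p0 ?mulr0//; exact: bounded_kerl.
have bx x : `|2 / b * ker x 0| <= 2 / b.
  rewrite normrM gtr0_norm ?divr_gt0// gtr0_norm ?ker_gt0//.
  by rewrite ler_piMr ?ker_le1// ltW// divr_gt0.
apply: ulim_le => // [|x]; first by exists (2 / b).
rewrite -(ulim_cst q (2 / b * ker x 0)); apply: ulim_le_near.
- exact: bounded_ker.
- by exists (2 / b) => _.
apply: filterS Hq => y by2; apply: le_trans (ker_harnack x y 0) _.
rewrite ler_wpM2r ?(ltW (ker_gt0 _ _))// subr0.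
rewrite ler_pdivlMr//; have := ker_norm y 0; rewrite addr0 => ->.
rewrite addrCA subrr addr0 mulrC ler_pdivrMr ?ker_gt0//; lra.
Qed.

Lemma type_determining_ker (p : set_system X) (x_ : nat -> X) : UltraFilter p ->
  0 < ulim p (ker^~ 0) ->
  (forall t, ker (x_ n) t @[n --> \oo] --> ulim p (ker^~ t)) ->
  forall t, `|t + x_ n| @[n --> \oo] --> (ulim p (ker^~ t))^-1 - 1.
Proof.
move=> pU p0 xp t; under eq_fun do rewrite addrC ker_norm.
apply: cvgB; last exact: cvg_cst.
by apply: cvgV => //; rewrite gt_eqF// ulim_ker_gt0.
Qed.

(** If the norm tends to infinity along p or q, both iterated limits vanish.
  Otherwise type determining sequences realize the limits of ker along p and q,
  as well as the two outer limits, and stability equates the latter after the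
  decreasing change of variable from the norm to ker. *)
Lemma stable_double_limits : separable_space X -> stable_space X ->
  double_limits ker.
Proof.
move=> Xsep Xst p q pU qU.
have [p0|p0] := eqVneq (ulim p (ker^~ 0)) 0.
  by have [-> ->] := double_ulim0 pU qU p0.
have [q0|q0] := eqVneq (ulim q (ker^~ 0)) 0.
  have [Hq Hp] := double_ulim0 qU pU q0.
  by rewrite (funext (ulim_kerE q)) Hp -(funext (ulim_kerE p)) Hq.
have {}p0 : 0 < ulim p (ker^~ 0) by rewrite lt_def p0 ulim_ker_ge0.
have {}q0 : 0 < ulim q (ker^~ 0) by rewrite lt_def q0 ulim_ker_ge0.
have bq : bounded_func (fun x => ulim q (ker^~ x)).
  by exists 1 => x; rewrite ulim_ker_le1.
have bp : bounded_func (fun x => ulim p (ker^~ x)).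
  by exists 1 => x; rewrite ulim_ker_le1.
have ksep := ker_separable Xsep.
have [x_ [xq /(type_determining_ker pU p0) xp]] := ultra_seq ksep ker_bounded bq pU.
have [y_ [yp /(type_determining_ker qU q0) yq]] := ultra_seq ksep ker_bounded bp qU.
have tdx : type_determining x_ by move=> t; apply/cvg_ex; exists ((ulim p (ker^~ t))^-1 - 1); exact: xp.
have tdy : type_determining y_ by move=> t; apply/cvg_ex; exists ((ulim q (ker^~ t))^-1 - 1); exact: yq.
have [cx cy] := Xst x_ y_ tdx tdy.
have ex : (fun n => lim (`|x_ n + y_ m| @[m --> \oo])) =
    (fun n => (ulim q (ker^~ (x_ n)))^-1 - 1).
  by apply/funext => n; apply/cvg_lim => //; exact: yq.
have ey : (fun m => lim (`|x_ n + y_ m| @[n --> \oo])) =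
    (fun m => (ulim p (ker^~ (y_ m)))^-1 - 1).
  apply/funext => m; apply/cvg_lim => //.
  by under eq_fun do rewrite addrC; exact: xp.
move: cx cy; rewrite ex ey => /cvg_ex[l cx] cy.
rewrite (cvg_lim _ cx)// => l_eq.
have {}cy : (ulim p (ker^~ (y_ m)))^-1 - 1 @[m --> \oo] --> l by rewrite l_eq.
have inv (u : nat -> R) : (forall n, 0 < u n <= 1) ->
    (u n)^-1 - 1 @[n --> \oo] --> l -> u n @[n --> \oo] --> (1 + l)^-1.
  move=> u01 ul.
  have l0 : 0 <= l.
    apply: cvgr_to_ge ul _; apply: nearW => n.
    by have /andP[? ?] := u01 n; rewrite subr_ge0 invf_ge1.
  have -> : u = fun n => (1 + ((u n)^-1 - 1))^-1.
    by apply/funext => n; rewrite addrC subrK invrK.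
  apply: cvgV; first by rewrite gt_eqF// ltr_pwDl.
  by apply: cvgD => //; exact: cvg_cst.
have u01 (r : set_system X) t : UltraFilter r -> 0 < ulim r (ker^~ 0) ->
    0 < ulim r (ker^~ t) <= 1.
  move=> rU r0; rewrite ulim_ker_gt0//= (le_trans (ler_norm _))//.
  exact: ulim_ker_le1.
rewrite (funext (ulim_kerE q)).
have xl := inv _ (fun n => u01 q (x_ n) qU q0) cx.
have yl := inv _ (fun n => u01 p (y_ n) pU p0) cy.
rewrite -(cvg_unique _ xl xq)//; exact: cvg_unique yl yp.
Qed.

End StableKernel.

(** * Separation and Goldstine's theorem *)

Section Helly.
Context {R : realType}.

Lemma sqr_neg_part (u v : R) : Num.max 0 (- (u + v)) ^+ 2 <=
  Num.max 0 (- u) ^+ 2 - 2 * Num.max 0 (- u) * v + v ^+ 2.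
Proof.
case: (ltrP 0 (- u)) => u0; case: (ltrP 0 (- (u + v))) => uv; rewrite ?mulr0.
- by rewrite le_eqVlt; apply/orP; left; apply/eqP; ring.
- rewrite expr0n/= (_ : _ + _ = (u + v) ^+ 2); last by ring.
  exact: sqr_ge0.
- have : 0 <= u * - (2 * v + u) by rewrite mulr_ge0; lra.
  by rewrite !expr2; lra.
- by rewrite expr0n/= mul0r subr0 add0r sqr_ge0.
Qed.

(** The squared distance of g to the nonnegative orthant is F g, the sum of the
  squares of the negative parts m g i. If its infimum were positive, an almost
  closest point g could be moved closer, towards the point that the hypothesis
  supplies for the nonnegative functional with coefficients m g. *)
Lemma helly_orthant (I : eqType) (s : seq I) (G : set (I -> R)) (B : R) :
  (forall g h (t : R), G g -> G h -> 0 <= t <= 1 ->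
     G (fun i => (1 - t) * g i + t * h i)) ->
  (forall g i, G g -> i \in s -> `|g i| <= B) ->
  (forall (c : I -> R) (d : R), (forall i, 0 <= c i) -> 0 < d ->
     exists2 g, G g & - d <= \sum_(i <- s) c i * g i) ->
  forall d : R, 0 < d -> exists2 g, G g & forall i, i \in s -> - d <= g i.
Proof.
move=> Gconv GB Gsep.
pose m (g : I -> R) i := Num.max 0 (- g i).
pose F (g : I -> R) := \sum_(i <- s) m g i ^+ 2.
have F0 g : 0 <= F g by apply: sumr_ge0 => i _; exact: sqr_ge0.
have m0 g i : 0 <= m g i by rewrite le_max lexx.
have [g0 Gg0 _] := Gsep (fun=> 0) 1 (fun=> lexx 0) ltr01.
have infF : has_inf (F @` G).
  by split; [exists (F g0), g0|exists 0 => _ [g _ <-]].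
set d0 := inf (F @` G).
have d0_le g : G g -> d0 <= F g by move=> Gg; apply: (inf_lbound infF.2); exists g.
pose V := \sum_(i <- s) (2 * B) ^+ 2.
have V0 : 0 <= V by apply: sumr_ge0 => i _; exact: sqr_ge0.
have step g h (t : R) : G g -> G h -> 0 <= t <= 1 ->
    F (fun i => (1 - t) * g i + t * h i) <=
    (1 - 2 * t) * F g - 2 * t * (\sum_(i <- s) m g i * h i) + t ^+ 2 * V.
  move=> Gg Gh /andP[t0 t1].
  rewrite /F /V !mulr_sumr -sumrB -big_split/= big_seq [leRHS]big_seq.
  apply: ler_sum => i si.
  have := GB g i Gg si; have := GB h i Gh si.
  rewrite !ler_norml => /andP[h1 h2] /andP[g1 g2].
  have gh : (h i - g i) ^+ 2 <= (2 * B) ^+ 2 by nra.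
  have mg : m g i * g i = - m g i ^+ 2.
    by rewrite /m; case: (ltrP 0 (- g i)) => _; ring.
  have H1 : m (fun i => (1 - t) * g i + t * h i) i ^+ 2 <=
      m g i ^+ 2 - 2 * t * m g i * (h i - g i) + t ^+ 2 * (h i - g i) ^+ 2.
    have := sqr_neg_part (g i) (t * (h i - g i)).
    rewrite /m (_ : g i + _ = (1 - t) * g i + t * h i); last by ring.
    by rewrite exprMn; lra.
  have t2 : 0 <= t ^+ 2 by exact: sqr_ge0.
  have H2 : 2 * t * m g i * (h i - g i) =
      2 * t * (m g i * h i) + 2 * t * m g i ^+ 2.
    by rewrite -[_ ^+ 2]opprK -mg; ring.
  have := ler_wpM2l t2 gh; move: H1; rewrite H2.
  move: (t ^+ 2 * (h i - g i) ^+ 2) (t ^+ 2 * (2 * B) ^+ 2) (m g i * h i) => a b c.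
  move: (m g i ^+ 2) => z; lra.
have d00 : d0 <= 0.
  rewrite leNgt; apply/negP => d0gt.
  have V2 : 0 < 2 + V by rewrite ltr_wpDr.
  (* a step t changes the squared distance d0 to at most (1 - 2 t) d0 + O(t ^ 2) *)
  pose t := Num.min (1 / 2) (d0 / (2 + V)).
  have t0 : 0 < t by rewrite lt_min !divr_gt0.
  have t2 : t <= 1 / 2 by rewrite ge_min lexx.
  have tV : t * (2 + V) <= d0 by rewrite -ler_pdivlMr// ge_min lexx orbT.
  have tt : 0 < t ^+ 2 by rewrite exprn_gt0.
  have [_ [g Gg <-] Fg] := inf_adherent tt infF.
  have [h Gh Hh] := Gsep (m g) _ (m0 g) tt.
  have t01 : 0 <= t <= 1 by apply/andP; split; lra.
  have := le_trans (d0_le _ (Gconv _ _ _ Gg Gh t01)) (step _ _ _ Gg Gh t01).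
  rewrite -/d0 in Fg.
  have : (1 - 2 * t) * F g <= (1 - 2 * t) * (d0 + t ^+ 2).
    by apply: ler_wpM2l; [lra|exact: ltW].
  have := ler_wpM2l (ltW t0) Hh.
  have := ler_wpM2l (ltW t0) tV.
  move: (F g) (\sum_(i <- s) m g i * h i) Fg => Fg S HFg.
  nra.
move=> d dgt; have dd : 0 < d ^+ 2 by rewrite exprn_gt0.
have [_ [g Gg <-] Fg] := inf_adherent dd infF.
exists g => // i si.
have : m g i ^+ 2 <= d ^+ 2.
  have Fi : m g i ^+ 2 <= F g.
    rewrite /F (big_rem i)//= lerDl; apply: sumr_ge0 => j _; exact: sqr_ge0.
  rewrite -/d0 in Fg; lra.
rewrite ler_pXn2r ?nnegrE ?m0 ?(ltW dgt)// => H.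
by rewrite lerNl; apply: le_trans H; rewrite le_max lexx orbT.
Qed.

Definition is_convex (V : lmodType R) (A : set V) : Prop :=
  forall a b (t : R), A a -> A b -> 0 <= t <= 1 -> A ((1 - t) *: a + t *: b).

Lemma is_convex_sum (V : lmodType R) (A : set V) (I : eqType) (s : seq I)
    (c : I -> R) (a : I -> V) :
  is_convex A -> (forall i, 0 <= c i) -> (forall i, i \in s -> A (a i)) ->
  0 < \sum_(i <- s) c i ->
  A ((\sum_(i <- s) c i)^-1 *: \sum_(i <- s) c i *: a i).
Proof.
move=> Aconv c0; elim: s => [|i s IHs] As; first by rewrite big_nil ltxx.
rewrite !big_cons.
have S0 : 0 <= \sum_(j <- s) c j by exact: sumr_ge0.
have [Sgt|] := ltrP 0 (\sum_(j <- s) c j); last first.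
  move=> Sle; have S_eq : \sum_(j <- s) c j = 0 by apply/eqP; rewrite eq_le Sle.
  have -> : \sum_(j <- s) c j *: a j = 0.
    have /eqP := S_eq; rewrite psumr_eq0// => /allP cs.
    rewrite big_seq big1// => j /cs /= /eqP ->; exact: scale0r.
  rewrite S_eq !addr0 => ci; rewrite scalerA mulVf ?gt_eqF// scale1r.
  by apply: As; rewrite mem_head.
move=> T0; set S := \sum_(j <- s) c j in S0 Sgt T0 *.
have := Aconv (a i) (S^-1 *: \sum_(j <- s) c j *: a j) (S / (c i + S)).
have -> : 1 - S / (c i + S) = c i / (c i + S) by field; rewrite gt_eqF.
rewrite scalerA mulrAC divff ?gt_eqF// mul1r scalerDr scalerA [_^-1 * _]mulrC.
apply; first by apply: As; rewrite mem_head.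
  by apply: IHs => // j js; apply: As; rewrite inE js orbT.
by rewrite divr_ge0 ?(ltW Sgt) ?(ltW T0)//= ler_pdivrMr// mul1r lerDr c0.
Qed.

(** A functional of norm at most 1, the limit of measures along q, separates 0 from
  a bounded convex set of functions of norms larger than e. For finitely many
  elements of A, a single measure is enough by helly_orthant, because an average
  of them is larger than e in absolute value at some point x, so that a Dirac
  mass at x, up to sign, is large on this average. The ultrafilter q glues these
  measures together. *)
Lemma minimax_ultra (X : Type) (A : set (X -> R)) (B e : R) :
  is_convex A -> (forall a x, A a -> `|a x| <= B) -> 0 < e ->
  (forall a, A a -> exists x, e < `|a x|) ->
  exists2 q : set_system (fmeas X 1), UltraFilter q &
    forall a, A a -> \forall nu \near q, e / 2 <= meas_int (val nu) a.
Proof.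
move=> Aconv AB e0 Ae.
have e2 : 0 < e / 2 by rewrite divr_gt0.
have mass_nil1 : mass (T := X) [::] <= 1 :> R by rewrite mass_nil ler01.
have fin (l : seq (X -> R)) : (forall a, a \in l -> A a) ->
    exists nu : fmeas X 1, forall a, a \in l -> e / 2 <= meas_int (val nu) a.
  move=> lA.
  have [|g a [nu ->] al|c d c0 dgt|_ [nu ->] Hnu] := @helly_orthant _ l
    [set g | exists nu : fmeas X 1, g = fun a => meas_int (val nu) a - e] (`|B| + e) _ _ _ _ e2.
  - move=> _ _ t [mu ->] [nu ->] /andP[t0 t1].
    have mt : mass (scalem (1 - t) (val mu) ++ scalem t (val nu)) <= 1.
      rewrite mass_cat !massZ !ger0_norm ?subr_ge0//.
      have := valP mu; have := valP nu; move: (mass _) (mass _) => m n /= n1 m1.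
      nra.
    exists (to_fmeas mt); apply/funext => a /=.
    by rewrite meas_int_cat !meas_intZ; ring.
  - rewrite (le_trans (ler_normB _ _))// lerD//; last by rewrite gtr0_norm.
    rewrite -[leRHS]mul1r; apply: fmeas_bound => // x.
    exact: le_trans (AB _ _ (lA _ al)) (ler_norm _).
  - have [cs|cs] := ltrP 0 (\sum_(a <- l) c a); last first.
      have c_eq : \sum_(a <- l) c a = 0 by apply/eqP; rewrite eq_le cs sumr_ge0.
      exists (fun a => meas_int (val (to_fmeas mass_nil1)) a - e); first by eexists.
      under eq_bigr do rewrite /= meas_int_nil sub0r.
      by rewrite -mulr_suml c_eq mul0r lerNl oppr0 ltW.
    have := is_convex_sum (a := id) Aconv c0 lA cs.
    set S := \sum_(a <- l) c a in cs *.
    set b := _ *: _ => /Ae[x bx].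
    have sg1 : mass [:: (Num.sg (b x), x)] <= 1.
      by rewrite /mass big_seq1 /= normr_sg; case: eqP.
    exists (fun a => meas_int (val (to_fmeas sg1)) a - e); first by eexists.
    have -> : \sum_(a <- l) c a * (meas_int [:: (Num.sg (b x), x)] a - e) = S * (`|b x| - e).
      under eq_bigr do rewrite /meas_int big_seq1/= mulrBr mulrCA.
      rewrite sumrB -mulr_suml -/S -mulr_sumr mulrBr; congr (_ - _).
      rewrite normrEsg mulrCA; congr (_ * _).
      rewrite /b /= fct_sumE mulrA divff ?gt_eqF// mul1r.
      by apply: eq_bigr.
    have : 0 < S * (`|b x| - e) by rewrite mulr_gt0// subr_gt0.
    lra.
  by exists nu => a /Hnu; lra.
pose D := [set l : seq (X -> R) | forall a, a \in l -> A a].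
pose Bs (l : seq (X -> R)) := [set nu : fmeas X 1 | forall a, a \in l -> e / 2 <= meas_int (val nu) a].
have FF : ProperFilter (filter_from D Bs).
  apply: filter_from_proper; last by move=> l /fin[nu ?]; exists nu.
  apply: filter_from_filter; first by exists [::].
  move=> l l' Dl Dl'; exists (l ++ l').
    by move=> a; rewrite mem_cat => /orP[/Dl|/Dl'].
  by move=> nu H; split => a al; apply: H; rewrite mem_cat al ?orbT.
have [q [qU Fq]] := ultraFilterLemma FF.
exists q => // a Aa; apply: Fq; exists [:: a].
  by move=> b; rewrite inE => /eqP ->.
by move=> nu; apply; rewrite mem_head.
Qed.

End Helly.

Section Goldstine.
Context {R : realType} {E : normedModType R}.
Implicit Types (f g : E -> R) (phi : (E -> R) -> R).

Lemma dual_bounded f : dual f -> has_sup [set `|f x| | x in [set x : E | `|x| <= 1]].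
Proof.
move=> [fl fc]; split; first by exists `|f 0|, 0 => //=; rewrite normr0.
have f0 : f 0 = 0.
  by have := fl (-1) 0 0; rewrite scaler0 addr0 mulN1r addNr.
have /cvgrPdist_lt/(_ _ ltr01) := fc 0.
rewrite f0 => /nbhs_ballP[r /= r0 Hr].
exists (2 / r) => _ [x /= x1 <-].
have fZ : f ((r / 2) *: x) = r / 2 * f x.
  by have := fl (r / 2) x 0; rewrite addr0 f0 addr0.
have := Hr ((r / 2) *: x); rewrite -ball_normE /= !sub0r !normrN normrZ fZ.
have r2 : 0 < r / 2 by rewrite divr_gt0.
rewrite (normrM (r / 2)) (gtr0_norm r2) => H.
have {}H : r / 2 * `|f x| < 1.
  by apply: H; rewrite (le_lt_trans (ler_piMr (ltW r2) x1))//; lra.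
by move: H; rewrite -ltr_pdivlMl// invf_div mulr1 => /ltW.
Qed.

Lemma dual_contraction f : scalar f -> (forall x, `|f x| <= `|x|) -> dual f.
Proof.
move=> fl f1; split => // x; apply/cvgrPdist_lt => e e0.
have fB y : f x - f y = f (x - y).
  by rewrite (addrC x) -[- y]scaleN1r fl mulN1r addrC.
near=> y; rewrite fB; apply: le_lt_trans (f1 _) _; near: y.
exact: cvgr_dist_lt.
Unshelve. all: by end_near. Qed.

Lemma dual_norm_ge0 f : dual f -> 0 <= dual_norm f.
Proof.
move=> df; apply: le_trans (normr_ge0 (f 0)) _.
by apply: (sup_upper_bound (dual_bounded df)); exists 0 => //=; rewrite normr0.
Qed.

Lemma dual0 f : dual f -> f 0 = 0.
Proof. by move=> [fl _]; have := fl (-1) 0 0; rewrite scaler0 addr0 mulN1r addNr. Qed.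

Lemma dualZ f a x : dual f -> f (a *: x) = a * f x.
Proof. by move=> df; have := df.1 a x 0; rewrite addr0 (dual0 df) addr0. Qed.

Lemma dualB f x y : dual f -> f (x - y) = f x - f y.
Proof. by move=> df; rewrite -scaleN1r addrC df.1 mulN1r addrC. Qed.

Lemma dual_le f x : dual f -> `|f x| <= dual_norm f * `|x|.
Proof.
move=> df; have [->|x0] := eqVneq x 0; first by rewrite (dual0 df) !normr0 mulr0.
have nx : 0 < `|x| by rewrite normr_gt0.
rewrite -ler_pdivrMr//; apply: (sup_upper_bound (dual_bounded df)).
exists (`|x|^-1 *: x) => /=.
  by rewrite normrZ normfV normr_id mulVf ?gt_eqF.
by rewrite (dualZ _ _ df) normrM normfV normr_id mulrC.
Qed.

Lemma dual_comb f g (a : R) : dual f -> dual g -> dual (fun x => a * f x + g x).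
Proof.
move=> [fl fc] [gl gc]; split => [b x y|x].
  by rewrite fl gl; ring.
by apply: cvgD; [apply: cvgM; [exact: cvg_cst|exact: fc]|exact: gc].
Qed.

Lemma dual_zero : dual (fun _ : E => 0 : R).
Proof. by split=> [a x y|x]; [rewrite mulr0 addr0|exact: cvg_cst]. Qed.

Section Bidual.
Variables (phi : (E -> R) -> R) (M : R).
Hypothesis phi_lin : forall (a : R) f g, dual f -> dual g ->
  phi (fun x => a * f x + g x) = a * phi f + phi g.
Hypothesis phi_le : forall f, dual f -> `|phi f| <= M * dual_norm f.

Lemma bidual_zero : phi (fun=> 0) = 0.
Proof.
have := phi_lin (-1) dual_zero dual_zero.
by rewrite mulr0 addr0 => ->; rewrite mulN1r addNr.
Qed.

Lemma bidual_sum (s : seq (E -> R)) (c : (E -> R) -> R) :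
  (forall f, f \in s -> dual f) ->
  dual (fun x => \sum_(f <- s) c f * f x) /\
  phi (fun x => \sum_(f <- s) c f * f x) = \sum_(f <- s) c f * phi f.
Proof.
elim: s => [|f s IHs] ds.
  rewrite big_nil; under eq_fun do rewrite big_nil.
  by split; [exact: dual_zero|exact: bidual_zero].
have [|ds' eqs] := IHs; first by move=> g gs; apply: ds; rewrite inE gs orbT.
have df : dual f by apply: ds; rewrite mem_head.
under eq_fun do rewrite big_cons.
by split; [exact: dual_comb|rewrite big_cons phi_lin// eqs].
Qed.

(** Goldstine's theorem: helly_orthant is applied to the vectors of values of finitely
  many functionals and of their opposites on the ball; on a nonnegative
  combination L of them, phi is at most the supremum of L on the ball. *)
Lemma goldstine : exists2 p : set_system E, UltraFilter p &
  p [set x | `|x| <= `|M|] /\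
  forall f, dual f -> forall e : R, 0 < e -> \forall x \near p, `|f x - phi f| <= e.
Proof.
have phiN f : dual f -> phi (fun x => - f x) = - phi f.
  move=> df; have := phi_lin (-1) df dual_zero.
  by rewrite bidual_zero addr0 mulN1r => <-; congr phi; apply/funext => x; rewrite addr0 mulN1r.
have dualN f : dual f -> dual (fun x => - f x).
  move=> df; have := dual_comb (-1) df dual_zero.
  by congr dual; apply/funext => x; rewrite addr0 mulN1r.
have one_sided (s : seq (E -> R)) (e : R) : 0 < e -> (forall f, f \in s -> dual f) ->
    exists2 x, `|x| <= `|M| & forall f, f \in s -> - e <= f x - phi f.
  move=> e0 ds.
  have [|g f [x xM Hg] fs|c d c0 dgt|g [x xM Hg] Hx] := @helly_orthant R _ s
    [set g | exists2 x, `|x| <= `|M| & forall f, f \in s -> g f = f x - phi f]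
    (\sum_(f <- s) (dual_norm f * `|M| + `|phi f|)) _ _ _ _ e0.
  - move=> g h t [x xM Hg] [y yM Hh] /andP[t0 t1].
    exists ((1 - t) *: x + t *: y).
      rewrite (le_trans (ler_normD _ _))// !normrZ (ger0_norm t0) (@ger0_norm _ (1 - t)) ?subr_ge0//.
      apply: le_trans (lerD (ler_wpM2l _ xM) (ler_wpM2l t0 yM)) _.
        by rewrite subr_ge0.
      by rewrite -mulrDl subrK mul1r.
    move=> f fs; have df := ds f fs.
    by rewrite Hg// Hh// (df.1 (1 - t)) (dualZ _ _ df); ring.
  - rewrite Hg// (big_rem f)//= -[leLHS]addr0 lerD//.
      rewrite (le_trans (ler_normB _ _))// lerD//.
      rewrite (le_trans (dual_le _ (ds _ fs)))// ler_wpM2l// dual_norm_ge0//.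
      exact: ds.
    rewrite big_seq sumr_ge0// => h /mem_rem hs.
    by rewrite addr_ge0// mulr_ge0// dual_norm_ge0//; exact: ds.
  - have [dL phiL] := bidual_sum c ds.
    set L := (fun x => _) in dL phiL.
    have dM : 0 < d / (`|M| + 1) by rewrite divr_gt0// ltr_wpDl.
    have [_ [y /= y1 <-] Ly] := sup_adherent dM (dual_bounded dL).
    pose x := (`|M| * Num.sg (L y)) *: y.
    exists (fun f => f x - phi f).
      exists x => //; rewrite normrZ normrM normr_id normr_sg.
      rewrite -mulrA ler_piMr// -[leRHS]mulr1 ler_pM//.
      by case: eqP.
    under eq_bigr do rewrite mulrBr.
    rewrite sumrB -phiL -[X in _ <= X - _]/(L x) (dualZ _ _ dL) -mulrA -normrEsg.
    have := ler_wpM2l (normr_ge0 M) (ltW Ly).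
    rewrite mulrBr -/(dual_norm L).
    have : `|M| * (d / (`|M| + 1)) <= d.
      rewrite mulrCA ler_piMr ?(ltW dgt)// ler_pdivrMr ?ltr_wpDl// mul1r.
      by rewrite lerDl.
    have : phi L <= `|M| * dual_norm L.
      apply: le_trans (le_trans (ler_norm _) (phi_le dL)) _.
      by rewrite ler_wpM2r ?dual_norm_ge0// ler_norm.
    lra.
  by exists x => // f fs; rewrite -Hg// Hx.
pose D := [set se : seq (E -> R) * R | (forall f, f \in se.1 -> dual f) /\ 0 < se.2].
pose Bs (se : seq (E -> R) * R) :=
  [set x : E | `|x| <= `|M| /\ forall f, f \in se.1 -> `|f x - phi f| <= se.2].
have FF : ProperFilter (filter_from D Bs).
  apply: filter_from_proper => [|[s e] [/= ds e0]].
    apply: filter_from_filter; first by exists ([::], 1); split => //=.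
    move=> [s e] [s' e'] [/= ds e0] [/= ds' e0']; exists (s ++ s', Num.min e e').
      by split => /= [f|]; rewrite ?mem_cat ?lt_min ?e0// => /orP[/ds|/ds'].
    move=> x [xM /= H]; split; split => // f fs.
      by have := H f; rewrite mem_cat fs le_min => /(_ isT)/andP[].
    by have := H f; rewrite mem_cat fs orbT le_min => /(_ isT)/andP[].
  have [f|x xM Hx] := one_sided (s ++ [seq (fun x => - f x) | f : E -> R <- s]) e e0.
    by rewrite mem_cat => /orP[/ds//|/mapP[g /ds dg ->]]; exact: dualN.
  exists x; split => // f fs; rewrite ler_norml Hx ?mem_cat ?fs//=.
  have := Hx (fun x => - f x); rewrite phiN; last exact: ds.
  have -> : (fun x => - f x) \in s ++ [seq (fun x => - f x) | f : E -> R <- s].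
    by rewrite mem_cat (map_f (fun f : E -> R => fun x => - f x) fs) orbT.
  by move=> /(_ isT); lra.
have [p [pU Fp]] := ultraFilterLemma FF.
exists p => //; split.
  by apply: Fp; exists ([::], 1) => [|x []]; first by split.
move=> f df e e0; apply: Fp; exists ([:: f], e).
  by split => //= g; rewrite inE => /eqP ->.
by move=> x [_]; apply; rewrite /= mem_head.
Qed.

End Bidual.
End Goldstine.

(** * Interpolation norms *)

Section BoundedFunc.
Context {R : realType} {T : Type}.
Implicit Types (z w : T -> R).

Lemma bounded_funcD z w : bounded_func z -> bounded_func w -> bounded_func (z + w).
Proof.
move=> [C zC] [D wD]; exists (C + D) => t.
by rewrite (le_trans (ler_normD _ _))// lerD.
Qed.

Lemma bounded_funcZ (c : R) z : bounded_func z -> bounded_func (c *: z).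
Proof. by move=> [C zC]; exists (`|c| * C) => t; rewrite normrM ler_wpM2l. Qed.

Lemma bounded_funcB z w : bounded_func z -> bounded_func w -> bounded_func (z - w).
Proof.
by move=> zb wb; apply: bounded_funcD => //; rewrite -scaleN1r; exact: bounded_funcZ.
Qed.

End BoundedFunc.

Section Interpolation.
Context {R : realType} {S T : Type} (k : S -> T -> R).
Hypothesis k_le1 : forall s t, `|k s t| <= 1.
Implicit Types (mu nu : seq (R * S)) (z w h : T -> R) (c C e M : R).

Definition comb mu : T -> R := fun t => meas_int mu (k^~ t).

Lemma comb_nil : comb [::] = 0.
Proof. by apply/funext => t; rewrite /comb meas_int_nil. Qed.

Lemma comb_cat mu nu : comb (mu ++ nu) = comb mu + comb nu.
Proof. by apply/funext => t; rewrite /comb meas_int_cat. Qed.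

Lemma combZ c mu : comb (scalem c mu) = c *: comb mu.
Proof. by apply/funext => t; rewrite /comb meas_intZ. Qed.

Lemma comb_le mu t : `|comb mu t| <= mass mu.
Proof. by rewrite -[leRHS]mulr1; apply: meas_int_bound. Qed.

Lemma bounded_comb mu : bounded_func (comb mu).
Proof. by exists (mass mu) => t; exact: comb_le. Qed.

(** The n-th norm in the construction of Davis, Figiel, Johnson and Pelczynski, here
  the infimal convolution of two multiples of norms: 4 ^ -n times the gauge of the
  absolutely convex hull of the functions k s, and 2 ^ n times the supremum. What
  matters is that 2 ^ n is unbounded, so that a set bounded for all of these norms
  is, up to small uniform errors, contained in multiples of the hull, and that
  4 ^ -n * 2 ^ n is summable. *)
Definition Kset n z : set R := [set c | exists mu C,
  [/\ 0 <= C, forall t, `|z t - comb mu t| <= C & c = 4^-1 ^+ n * mass mu + 2 ^+ n * C]].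
Definition K n z : R := inf (Kset n z).

Let p4 n : 0 < 4^-1 ^+ n :> R. Proof. by rewrite exprn_gt0// invr_gt0. Qed.
Let p2 n : 0 < 2 ^+ n :> R. Proof. by rewrite exprn_gt0. Qed.

Lemma Kset_ge0 n z c : Kset n z c -> 0 <= c.
Proof.
move=> [mu [C [C0 _ ->]]].
by rewrite addr_ge0// mulr_ge0 ?(ltW (p4 _)) ?(ltW (p2 _)) ?mass_ge0.
Qed.

Lemma has_inf_K n z : bounded_func z -> has_inf (Kset n z).
Proof.
move=> [C zC]; split; last by exists 0 => c; exact: Kset_ge0.
exists (4^-1 ^+ n * mass (T := S) [::] + 2 ^+ n * `|C|), [::], `|C|.
split => // t; rewrite /comb meas_int_nil subr0.
exact: le_trans (zC t) (ler_norm _).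
Qed.

Lemma K_ge0 n z : 0 <= K n z.
Proof.
have [S0|/set0P S0] := eqVneq (Kset n z) set0; first by rewrite /K S0 inf0.
by apply: lb_le_inf => // c; exact: Kset_ge0.
Qed.

Lemma K_le n z mu C : 0 <= C -> (forall t, `|z t - comb mu t| <= C) ->
  K n z <= 4^-1 ^+ n * mass mu + 2 ^+ n * C.
Proof.
move=> C0 zC; apply: inf_lbound; last by exists mu, C.
by exists 0 => c; exact: Kset_ge0.
Qed.

Lemma K_adherent n z e : bounded_func z -> K n z < e -> exists mu C,
  [/\ 0 <= C, forall t, `|z t - comb mu t| <= C & 4^-1 ^+ n * mass mu + 2 ^+ n * C < e].
Proof.
move=> zb; rewrite -subr_gt0 => /inf_adherent/(_ (has_inf_K n zb)).
move=> [_ [mu [C [C0 zC ->]]]]; rewrite -/(K n z) => H; exists mu, C; split => //.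
by move: H; lra.
Qed.

Lemma K_sup n z t : bounded_func z -> `|z t| <= 4 ^+ n * K n z.
Proof.
move=> zb; rewrite -ler_pdivrMl ?exprn_gt0//.
apply: lb_le_inf; first exact: (has_inf_K n zb).1.
move=> _ [mu [C [C0 zC ->]]]; rewrite -exprVn.
have : `|z t| <= mass mu + C.
  rewrite -[z t](subrK (comb mu t)) addrC (le_trans (ler_normD _ _))// lerD//.
  exact: comb_le.
move=> /(ler_wpM2l (ltW (p4 n)))/le_trans; apply; rewrite mulrDr lerD2l ler_wpM2r//.
rewrite (@le_trans _ _ 1)//.
  by rewrite exprn_ile1 ?invr_ge0// invf_le1// ler1n.
by rewrite exprn_ege1// ler1n.
Qed.

Lemma K_le_sup n z C : 0 <= C -> (forall t, `|z t| <= C) -> K n z <= 2 ^+ n * C.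
Proof.
move=> C0 zC; have := @K_le n z [::] C C0.
rewrite mass_nil mulr0 add0r; apply => t.
by rewrite comb_nil subr0.
Qed.

Lemma KD n z w : bounded_func z -> bounded_func w ->
  K n (z + w) <= K n z + K n w.
Proof.
move=> zb wb; apply/ler_addgt0Pl => e e0.
have e2 : 0 < e / 2 by rewrite divr_gt0.
have zlt : K n z < K n z + e / 2 by rewrite ltrDl.
have wlt : K n w < K n w + e / 2 by rewrite ltrDl.
have [mu [C [C0 zC Hz]]] := K_adherent zb zlt.
have [nu [D [D0 wD Hw]]] := K_adherent wb wlt.
have : K n (z + w) <= 4^-1 ^+ n * mass (mu ++ nu) + 2 ^+ n * (C + D).
  apply: K_le => [|t]; first exact: addr_ge0.
  rewrite comb_cat /= [X in `|X|](_ : _ = (z t - comb mu t) + (w t - comb nu t)).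
    by rewrite (le_trans (ler_normD _ _))// lerD.
  by rewrite !fctE; ring.
rewrite mass_cat !mulrDr; lra.
Qed.

Lemma KZ_le n c z : bounded_func z -> K n (c *: z) <= `|c| * K n z.
Proof.
move=> zb; have [->|c0] := eqVneq c 0.
  rewrite normr0 mul0r scale0r -(mulr0 (2 ^+ n)); apply: K_le_sup => // t.
  by rewrite normr0.
have cgt : 0 < `|c| by rewrite normr_gt0.
rewrite -ler_pdivrMl//; apply: lb_le_inf; first exact: (has_inf_K n zb).1.
move=> _ [mu [C [C0 zC ->]]]; rewrite ler_pdivrMl// mulrDr mulrCA -massZ mulrCA.
apply: K_le => [|t]; first exact: mulr_ge0.
by rewrite combZ !fctE -[_ *: z t]/(c * z t) -[c *: comb mu t]/(c * comb mu t)
  -mulrBr normrM ler_wpM2l.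
Qed.

Lemma KZ n c z : bounded_func z -> K n (c *: z) = `|c| * K n z.
Proof.
move=> zb; apply/eqP; rewrite eq_le KZ_le//=.
have [->|c0] := eqVneq c 0; first by rewrite normr0 mul0r K_ge0.
have cgt : 0 < `|c| by rewrite normr_gt0.
rewrite -ler_pdivlMl//.
have := @KZ_le n c^-1 (c *: z) (bounded_funcZ c zb).
by rewrite scalerA mulVf// scale1r normfV.
Qed.

Lemma K_comb n mu : K n (comb mu) <= 4^-1 ^+ n * mass mu.
Proof.
have := @K_le n (comb mu) mu 0 (lexx 0); rewrite mulr0 addr0; apply => t.
by rewrite subrr normr0.
Qed.

(** The closed balls of the l2-sum of the norms K n. Working with them avoids the
  functions for which this sum is infinite. *)
Definition Nle e z : Prop := forall n, \sum_(0 <= i < n) K i z ^+ 2 <= e ^+ 2.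

Lemma sum_K_mono z m n : (m <= n)%N ->
  \sum_(0 <= i < m) K i z ^+ 2 <= \sum_(0 <= i < n) K i z ^+ 2.
Proof.
move=> mn; rewrite [leRHS](big_cat_nat (leq0n _) mn)//= lerDl.
by apply: sumr_ge0 => i _; exact: sqr_ge0.
Qed.

Lemma NleK e z n : 0 <= e -> Nle e z -> K n z <= e.
Proof.
move=> e0 /(_ n.+1); rewrite big_nat_recr//= => H.
rewrite -(@ler_pXn2r _ 2)// ?nnegrE ?K_ge0//; apply: le_trans H.
by rewrite lerDr; apply: sumr_ge0 => i _; exact: sqr_ge0.
Qed.

Lemma Nle_sup e z t : 0 <= e -> bounded_func z -> Nle e z -> `|z t| <= e.
Proof.
move=> e0 zb ze; have := K_sup 0 t zb; rewrite expr0 mul1r => /le_trans; apply.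
exact: NleK.
Qed.

Lemma Nle_le e e' z : 0 <= e -> e <= e' -> Nle e z -> Nle e' z.
Proof.
move=> e0 ee ze n; apply: le_trans (ze n) _.
by rewrite ler_pXn2r// nnegrE// (le_trans e0).
Qed.

(** Minkowski's inequality, from (e' a - e b) ^ 2 >= 0. *)
Lemma NleD e e' z w : 0 <= e -> 0 <= e' -> bounded_func z -> bounded_func w ->
  Nle e z -> Nle e' w -> Nle (e + e') (z + w).
Proof.
move=> e0 e'0 zb wb ze we n.
have le1 : \sum_(0 <= i < n) K i (z + w) ^+ 2 <= \sum_(0 <= i < n) (K i z + K i w) ^+ 2.
  apply: ler_sum => i _; rewrite ler_pXn2r ?nnegrE ?addr_ge0 ?K_ge0//.
  exact: KD.
apply: le_trans le1 _.
have [e00|en0] := eqVneq e 0.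
  rewrite e00 add0r; apply: le_trans (we n); apply: ler_sum => i _.
  have -> : K i z = 0 by apply/eqP; rewrite eq_le K_ge0 andbT -[leRHS]e00 NleK.
  by rewrite add0r.
have [e00|en0'] := eqVneq e' 0.
  rewrite e00 addr0; apply: le_trans (ze n); apply: ler_sum => i _.
  have -> : K i w = 0 by apply/eqP; rewrite eq_le K_ge0 andbT -[leRHS]e00 NleK.
  by rewrite addr0.
have {en0}egt : 0 < e by rewrite lt_def en0.
have {en0'}e'gt : 0 < e' by rewrite lt_def en0'.
have ee : 0 < e * e' by exact: mulr_gt0.
rewrite -(ler_pM2l ee) mulr_sumr.
apply: (@le_trans _ _ (\sum_(0 <= i < n) ((e + e') * e' * K i z ^+ 2 + (e + e') * e * K i w ^+ 2))).
  apply: ler_sum => i _.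
  have : 0 <= (e' * K i z - e * K i w) ^+ 2 by exact: sqr_ge0.
  by move: (K i z) (K i w) => a b; rewrite !expr2; lra.
rewrite big_split/= -!mulr_sumr.
have pe : 0 <= (e + e') * e by rewrite mulr_ge0// addr_ge0.
have pe' : 0 <= (e + e') * e' by rewrite mulr_ge0// addr_ge0.
rewrite (le_trans (lerD (ler_wpM2l pe' (ze n)) (ler_wpM2l pe (we n))))//.
by rewrite le_eqVlt; apply/orP; left; apply/eqP; ring.
Qed.

Lemma NleZ c e z : bounded_func z -> Nle e z -> Nle (`|c| * e) (c *: z).
Proof.
move=> zb ze n; under eq_bigr do rewrite KZ// exprMn.
by rewrite -mulr_sumr exprMn ler_wpM2l ?sqr_ge0.
Qed.

(** Balls are closed for the supremum, as each partial sum is continuous for it. *)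
Lemma Nle_near e z : 0 <= e -> bounded_func z ->
  (forall d, 0 < d -> exists w, [/\ bounded_func w, Nle e w &
    forall t, `|z t - w t| <= d]) -> Nle e z.
Proof.
move=> e0 zb H n; apply/ler_addgt0Pl => eta eta0.
pose P := \sum_(0 <= i < n) (2 * 2 ^+ i * e + (2 ^+ i) ^+ 2).
have P0 : 0 <= P.
  by apply: sumr_ge0 => i _; rewrite addr_ge0 ?sqr_ge0// !mulr_ge0// (ltW (p2 _)).
pose d := Num.min 1 (eta / (P + 1)).
have d0 : 0 < d by rewrite lt_min ltr01 divr_gt0// ltr_wpDl.
have d1 : d <= 1 by rewrite ge_min lexx.
have dP : d * P <= eta.
  have : d * (P + 1) <= eta by rewrite -ler_pdivlMr ?ltr_wpDl// ge_min lexx orbT.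
  by rewrite mulrDr; lra.
have [w [wb we wd]] := H d d0.
have : \sum_(0 <= i < n) K i z ^+ 2 <= \sum_(0 <= i < n) K i w ^+ 2 + d * P.
  rewrite mulr_sumr -big_split; apply: ler_sum => i _ /=.
  have Kzw : K i z <= K i w + 2 ^+ i * d.
    have -> : z = w + (z - w) by rewrite addrC subrK.
    apply: le_trans (KD _ wb (bounded_funcB zb wb)) _.
    by rewrite lerD2l; apply: K_le_sup => //; exact: ltW.
  have := NleK i e0 we; have := K_ge0 i z; have := K_ge0 i w; have := p2 i.
  move: (K i z) (K i w) (2 ^+ i) Kzw => a b c Kab c0 b0 a0 be.
  apply: (@le_trans _ _ ((b + c * d) ^+ 2)).
    by rewrite ler_pXn2r// nnegrE// addr_ge0// mulr_ge0// ltW.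
  have H1 : c * d * b <= c * d * e by rewrite ler_wpM2l// mulr_ge0// ltW.
  have H2 : d * (d * (c * c)) <= d * (c * c).
    by rewrite ler_wpM2l ?(ltW d0)// ler_piMl// mulr_ge0// ltW.
  by rewrite !expr2; lra.
have := we n; lra.
Qed.

(** Combinations of bounded mass that tend to 0 for the supremum tend to 0 for the
  interpolation norm: the square of the n-th norm is at most the product of
  4 ^ -n * mass mu and 2 ^ n * C, the terms of a geometric series. *)
Lemma Nle_comb mu C e : (forall t, `|comb mu t| <= C) -> 0 <= C ->
  2 * mass mu * C <= e ^+ 2 -> Nle e (comb mu).
Proof.
move=> muC C0 He n; apply: le_trans He.
have half (m : nat) : \sum_(0 <= i < m) (2^-1 : R) ^+ i <= 2 - 2 * 2^-1 ^+ m.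
  elim: m => [|m IHm]; first by rewrite big_nil expr0; lra.
  rewrite big_nat_recr//= exprS; move: (2^-1 ^+ m) IHm => x; lra.
apply: (@le_trans _ _ (\sum_(0 <= i < n) (mass mu * C) * 2^-1 ^+ i)).
  apply: ler_sum => i _; rewrite expr2.
  have -> : mass mu * C * 2^-1 ^+ i = 4^-1 ^+ i * mass mu * (2 ^+ i * C) :> R.
    have -> : 4^-1 = 2^-1 * 2^-1 :> R by field.
    rewrite exprMn; have : 2^-1 ^+ i * 2 ^+ i = 1 :> R by rewrite -exprMn mulVf// expr1n.
    by move: (2^-1 ^+ i) (2 ^+ i) (mass mu) => x y m xy; rewrite -[LHS]mulr1 -xy; ring.
  by apply: ler_pM; rewrite ?K_ge0// ?K_comb// K_le_sup.
rewrite -mulr_sumr (_ : 2 * mass mu * C = mass mu * C * 2); last by ring.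
rewrite ler_wpM2l//.
  by rewrite mulr_ge0 ?mass_ge0.
by rewrite (le_trans (half n))// gerBl mulr_ge0// exprn_ge0// invr_ge0.
Qed.

Lemma Nle_comb_mass mu : Nle (2 * mass mu) (comb mu).
Proof.
apply: (@Nle_comb mu (mass mu)); [exact: comb_le|exact: mass_ge0|].
by rewrite exprMn !expr2; have := mass_ge0 mu; nra.
Qed.

(** A perturbation h of z that is small for the supremum is almost orthogonal to z:
  its first coordinates K i are small, and so are the last ones of z. *)
Lemma gliding_hump z A M e : bounded_func z ->
  (forall n, \sum_(0 <= i < n) K i z ^+ 2 <= A) -> 0 < e ->
  exists2 d, 0 < d & forall h, bounded_func h -> Nle M h ->
    (forall t, `|h t| <= d) ->
    forall n, \sum_(0 <= i < n) K i (z + h) ^+ 2 <= A + M ^+ 2 + e.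
Proof.
move=> zb zA e0.
have M0 : 0 <= M ^+ 2 by exact: sqr_ge0.
(* r balances the two terms of 2 a b <= r^-1 a ^ 2 + r b ^ 2 in the tail of the sum *)
pose r := e / 3 / (M ^+ 2 + 1).
have r0 : 0 < r by rewrite !divr_gt0// ltr_wpDl.
have rM : r * M ^+ 2 <= e / 3.
  rewrite /r -mulrA ler_piMr ?divr_ge0 ?(ltW e0)// mulrC ler_pdivrMr ?ltr_wpDl//.
  by rewrite mul1r lerDl.
have [m Hm] := near_sup_index zA (mulr_gt0 r0 (divr_gt0 e0 (ltr0n _ 3))).
pose P := \sum_(0 <= i < m) 2 * K i z * 2 ^+ i.
have P0 : 0 <= P.
  by apply: sumr_ge0 => i _; rewrite !mulr_ge0 ?K_ge0 ?(ltW (p2 _)).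
have d0 : 0 < e / 3 / (P + 1) by rewrite !divr_gt0// ltr_wpDl.
exists (e / 3 / (P + 1)) => // h hb hM hd n.
set d := e / 3 / (P + 1) in d0 hd.
have dP : P * d <= e / 3.
  rewrite /d mulrCA ler_piMr ?divr_ge0 ?(ltW e0)// ler_pdivrMr ?ltr_wpDl//.
  by rewrite mul1r lerDl.
apply: le_trans (sum_K_mono _ (leq_maxl n m)) _; set n' := maxn n m.
have mn' : (m <= n')%N by exact: leq_maxr.
have le1 : \sum_(0 <= i < n') K i (z + h) ^+ 2 <=
    \sum_(0 <= i < n') K i z ^+ 2 + \sum_(0 <= i < n') K i h ^+ 2
    + \sum_(0 <= i < n') 2 * K i z * K i h.
  rewrite -!big_split; apply: ler_sum => i _ /=.
  apply: (@le_trans _ _ ((K i z + K i h) ^+ 2)).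
    by rewrite ler_pXn2r ?nnegrE ?addr_ge0 ?K_ge0// KD.
  by rewrite le_eqVlt; apply/orP; left; apply/eqP; ring.
have cross1 : \sum_(0 <= i < m) 2 * K i z * K i h <= e / 3.
  apply: le_trans dP; rewrite mulr_suml; apply: ler_sum => i _.
  rewrite -[leRHS]mulrA ler_wpM2l ?mulr_ge0 ?K_ge0//.
  by apply: K_le_sup => //; exact: ltW.
have cross2 : \sum_(m <= i < n') 2 * K i z * K i h <= 2 * (e / 3).
  apply: (@le_trans _ _ (r^-1 * \sum_(m <= i < n') K i z ^+ 2
      + r * \sum_(m <= i < n') K i h ^+ 2)).
    rewrite !mulr_sumr -big_split; apply: ler_sum => i _ /=.
    rewrite -subr_ge0 (_ : _ - _ = r^-1 * (K i z - r * K i h) ^+ 2).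
      by rewrite mulr_ge0 ?sqr_ge0// invr_ge0 ltW.
    by field; rewrite gt_eqF.
  have zt : \sum_(m <= i < n') K i z ^+ 2 <= r * (e / 3).
    have := Hm n'; rewrite (big_cat_nat (leq0n _) mn')//=; lra.
  have ht : \sum_(m <= i < n') K i h ^+ 2 <= M ^+ 2.
    apply: le_trans (hM n'); rewrite [leRHS](big_cat_nat (leq0n _) mn')//= lerDr.
    by apply: sumr_ge0 => i _; exact: sqr_ge0.
  have := ler_wpM2l (ltW r0) ht.
  have : r^-1 * \sum_(m <= i < n') K i z ^+ 2 <= e / 3 by rewrite ler_pdivrMl.
  move: rM; move: (_ * _) (_ * \sum_(_ <= _ < _) _) (_ * M ^+ 2) => a b c; lra.
have := zA n'; have := hM n'.
have : \sum_(0 <= i < n') 2 * K i z * K i h <= e.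
  rewrite (big_cat_nat (leq0n _) mn')//=; lra.
move: le1; move: (\sum_(_ <= _ < _) _) => S1.
move: (\sum_(_ <= _ < _) _) (\sum_(_ <= _ < _) _) (\sum_(_ <= _ < _) _) (M ^+ 2) => S2 S3 S4 MM.
lra.
Qed.

(** The squared norm of a sum of r almost orthogonal perturbations a - z grows
  linearly in r, so the average of the a is at distance O(r ^ (-1/2)) from z. *)
Lemma convex_sup_to_Nle (A : set (T -> R)) z M : is_convex A ->
  bounded_func z -> (forall a, A a -> bounded_func a /\ Nle M (a - z)) ->
  (forall d, 0 < d -> exists2 a, A a & forall t, `|a t - z t| <= d) ->
  forall e, 0 < e -> exists2 a, A a & Nle e (a - z).
Proof.
move=> Aconv zb AM Asup e e0.
have avg r : exists2 a, A a & forall n,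
    \sum_(0 <= i < n) K i (r.+1%:R *: (a - z)) ^+ 2 <= r.+1%:R * (M ^+ 2 + 1).
  elim: r => [|r [a Aa Ha]].
    have [a Aa _] := Asup 1 ltr01; exists a => // n.
    by rewrite scale1r mul1r (le_trans ((AM a Aa).2 n))// lerDl.
  have azb : bounded_func (r.+1%:R *: (a - z)).
    by apply: bounded_funcZ; apply: bounded_funcB => //; exact: (AM a Aa).1.
  have [d d0 Hd] := gliding_hump M azb Ha ltr01.
  have [b Ab bd] := Asup d d0; have [bb bM] := AM b Ab.
  have := Hd (b - z) (bounded_funcB bb zb) bM bd.
  pose t : R := r.+2%:R^-1.
  have r2 : 0 < r.+2%:R :> R by rewrite ltr0n.
  have t01 : 0 <= t <= 1 by rewrite invr_ge0 ler0n invf_le1 ?ler1n.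
  move=> H; exists ((1 - t) *: a + t *: b); first exact: Aconv.
  have -> : r.+2%:R *: ((1 - t) *: a + t *: b - z) = r.+1%:R *: (a - z) + (b - z).
    apply/funext => x; rewrite !fctE /GRing.scale /= /t.
    rewrite -[r.+2]addn1 natrD; field.
    by rewrite gt_eqF// ltr_wpDl.
  move=> n; apply: le_trans (H n) _.
  by rewrite -[r.+2]addn1 natrD mulrDl mul1r addrA.
have [r Hr] : exists r, (M ^+ 2 + 1) / e ^+ 2 <= r.+1%:R.
  exists (Num.bound ((M ^+ 2 + 1) / e ^+ 2)).
  rewrite ltW// (lt_le_trans (archi_boundP _))// ?ler_nat//.
  by rewrite divr_ge0 ?sqr_ge0// addr_ge0 ?sqr_ge0.
have [a Aa Ha] := avg r; exists a => // n.
have r1 : 0 < r.+1%:R :> R by rewrite ltr0n.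
have azb := bounded_funcB (AM a Aa).1 zb.
have := Ha n; under eq_bigr do rewrite (KZ _ _ azb) exprMn.
rewrite -mulr_sumr (gtr0_norm r1) expr2 -mulrA ler_pM2l//.
rewrite ler_pdivrMr ?exprn_gt0// in Hr.
move=> /le_trans/(_ Hr); rewrite ler_pM2l//.
Qed.

End Interpolation.

(** * From pointwise to uniform approximation *)

Lemma meas_int_comb (R : realType) (S T : Type) (k : S -> T -> R) (mu : seq (R * S))
    (nu : seq (R * T)) :
  meas_int mu (fun s => meas_int nu (k s)) = meas_int nu (comb k mu).
Proof.
rewrite /meas_int /comb /meas_int; under eq_bigr do rewrite mulr_sumr.
rewrite exchange_big; apply: eq_bigr => b _; rewrite mulr_sumr.
by apply: eq_bigr => a _; rewrite mulrCA.
Qed.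

Lemma meas_int_cvg (R : realType) (T : Type) (p : set_system (T -> R))
    (nu : seq (R * T)) (z : T -> R) : Filter p ->
  (forall t, a t @[a --> p] --> z t) -> meas_int nu a @[a --> p] --> meas_int nu z.
Proof.
move=> pF pz; elim: nu => [|b nu IH].
  by under eq_fun do rewrite meas_int_nil; rewrite meas_int_nil; exact: cvg_cst.
rewrite /meas_int; under eq_fun do rewrite big_cons.
by rewrite big_cons; apply: cvgD => //; apply: cvgM; [exact: cvg_cst|exact: pz].
Qed.

Section PointwiseToUniform.
Context {R : realType} {S T : Type} (k : S -> T -> R).
Hypothesis k_le1 : forall s t, `|k s t| <= 1.
Hypothesis k_dl : forall C D : R,
  double_limits (fun (mu : fmeas S C) (nu : fmeas T D) =>
    meas_int (val mu) (fun s => meas_int (val nu) (k s))).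

(** A substitute for Mazur's theorem, for pointwise limits. If A stayed away from z
  for the supremum, a limit of measures along some q would separate z from A. But
  the elements of A are within d / 8 of combinations of the functions k s of
  bounded mass D, and the limits of these along p and q can be interchanged. *)
Lemma pointwise_to_uniform (p : set_system (T -> R)) (A : set (T -> R))
    (z : T -> R) (M : R) :
  UltraFilter p -> p A -> is_convex A -> 0 <= M ->
  (forall a, A a -> bounded_func a /\ Nle k M a) ->
  (forall t, a t @[a --> p] --> z t) ->
  forall d : R, 0 < d -> exists2 a, A a & forall t, `|a t - z t| <= d.
Proof.
move=> pU pA Aconv M0 AM pz d d0; apply: contrapT => H.
have Asup a t : A a -> `|a t| <= M.
  by move=> /AM[ba aM]; exact: Nle_sup aM.
have zM t : `|z t| <= M.
  have /cvg_norm/cvgr_to_le : a t @[a --> p] --> z t by exact: pz.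
  by apply; apply: filterS pA => a /(Asup a t).
have bz : bounded_func z by exists M.
have [|_ x [a Aa <-]|_ [a Aa <-]|q qU Hq] :=
    @minimax_ultra R T [set a - z | a in A] (M + M) d _ _ d0 _.
- move=> _ _ t [a Aa <-] [b Ab <-] t01; exists ((1 - t) *: a + t *: b).
    exact: Aconv.
  by apply/funext => x; rewrite !fctE /GRing.scale /=; ring.
- by rewrite (le_trans (ler_normB _ _))// lerD// Asup.
- apply: contrapT => /forallNP Ha; apply: H; exists a => // t.
  by rewrite leNgt; apply/negP; exact: Ha.
(* the weight 2 ^ n makes the error of approximation at most (M + 1) / 2 ^ n *)
have [n Hn] : exists n, 8 * (M + 1) / d <= 2 ^+ n.
  exists (Num.bound (8 * (M + 1) / d)).
  rewrite ltW// (lt_le_trans (archi_boundP _))//.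
    by rewrite divr_ge0 ?mulr_ge0 ?addr_ge0 ?(ltW d0).
  by rewrite -natrX ler_nat ltnW// ltn_expl.
have n0 : 0 < 2 ^+ n :> R by rewrite exprn_gt0.
have n4 : 0 < 4^-1 ^+ n :> R by rewrite exprn_gt0.
pose D := (M + 1) / 4^-1 ^+ n.
have mex (a : T -> R) : exists mu : fmeas S D,
    A a -> forall t, `|a t - comb k (val mu) t| <= d / 8.
  have D0 : mass (T := S) [::] <= D.
    by rewrite mass_nil divr_ge0 ?(ltW n4)// addr_ge0.
  have [Aa|nAa] := pselect (A a); last by exists (to_fmeas D0).
  have [ba aM] := AM a Aa.
  have [mu [C [C0 muC Hmu]]] := K_adherent ba (le_lt_trans (NleK n M0 aM) (ltr_pwDr ltr01 (lexx M))).
  have n4m : 0 <= 4^-1 ^+ n * mass mu by rewrite mulr_ge0 ?mass_ge0// ltW.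
  have n2C : 0 <= 2 ^+ n * C by rewrite mulr_ge0// ltW.
  have muD : mass mu <= D by rewrite ler_pdivlMr// mulrC; lra.
  exists (to_fmeas muD) => _ t; apply: le_trans (muC t) _.
  rewrite -(ler_pM2l n0); move: Hn; rewrite ler_pdivrMr//; lra.
have /choice[m Hm] := mex.
have bcomb (nu : fmeas T 1) : bounded_func (fun mu : fmeas S D => meas_int (val nu) (comb k (val mu))).
  exists D => mu; rewrite -[leRHS]mul1r; apply: fmeas_bound.
    exact: le_trans (mass_ge0 _) (valP mu).
  by move=> t; apply: le_trans (comb_le k_le1 _ _) (valP mu).
have mpU : UltraFilter (m @ p) := ultra_fmap m pU.
have := k_dl (C := D) (D := 1) mpU qU.
under eq_fun do under eq_fun do rewrite meas_int_comb.
under [X in _ = ulim q X]eq_fun do under eq_fun do rewrite meas_int_comb.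
pose c := ulim q (fun nu : fmeas T 1 => meas_int (val nu) z).
move=> eq_dl.
have bu : bounded_func (fun mu : fmeas S D => ulim q (fun nu : fmeas T 1 => meas_int (val nu) (comb k (val mu)))).
  exists D => mu; apply: ulim_bounded => nu; rewrite -[leRHS]mul1r; apply: fmeas_bound.
    exact: le_trans (mass_ge0 _) (valP mu).
  by move=> t; apply: le_trans (comb_le k_le1 _ _) (valP mu).
have bu' : bounded_func (fun nu : fmeas T 1 => ulim (m @ p) (fun mu : fmeas S D => meas_int (val nu) (comb k (val mu)))).
  exists D => nu; apply: ulim_bounded => mu; rewrite -[leRHS]mul1r; apply: fmeas_bound.
    exact: le_trans (mass_ge0 _) (valP mu).
  by move=> t; apply: le_trans (comb_le k_le1 _ _) (valP mu).
have bza (a : T -> R) : bounded_func a -> bounded_func (fun nu : fmeas T 1 => meas_int (val nu) a).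
  exact: fmeas_bounded.
have d8 : 0 < d / 8 by rewrite divr_gt0.
have near_a (a : T -> R) (nu : fmeas T 1) : A a ->
    `|meas_int (val nu) (comb k (val (m a))) - meas_int (val nu) a| <= d / 8.
  move=> Aa; rewrite -meas_intB -[leRHS]mul1r; apply: fmeas_bound; first exact: ltW.
  by move=> t; rewrite distrC; exact: Hm.
have lower : c + d / 2 - d / 8 <= ulim (m @ p) (fun mu : fmeas S D => ulim q (fun nu : fmeas T 1 => meas_int (val nu) (comb k (val mu)))).
  rewrite -[leLHS](ulim_cst (m @ p)); apply: ulim_le_near => //; first by exists `|c + d / 2 - d / 8|.
  change (p [set a | c + d / 2 - d / 8 <= ulim q (fun nu : fmeas T 1 => meas_int (val nu) (comb k (val (m a))))]).
  apply: filterS pA => a Aa /=.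
  have ba : bounded_func a := (AM a Aa).1.
  have H1 : `|ulim q (fun nu : fmeas T 1 => meas_int (val nu) (comb k (val (m a)))) - ulim q (fun nu : fmeas T 1 => meas_int (val nu) a)| <= d / 8.
    apply: ulim_dist; [exact/bza/bounded_comb|exact: bza|].
    by apply: nearW => nu; exact: near_a.
  have H2 : d / 2 <= ulim q (fun nu : fmeas T 1 => meas_int (val nu) a) - c.
    rewrite -ulimB; [|exact: bza..].
    under eq_fun do rewrite -meas_intB.
    rewrite -[leLHS](ulim_cst q); apply: ulim_le_near.
    - by exists `|d / 2|.
    - by apply: bza; exact: bounded_funcB.
    - by apply: Hq; exists a.
  by move: H1; rewrite ler_distl => /andP[+ _]; lra.
have upper : ulim q (fun nu : fmeas T 1 => ulim (m @ p) (fun mu : fmeas S D => meas_int (val nu) (comb k (val mu)))) <= c + (d / 8 + d / 8).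
  suff : `|ulim q (fun nu : fmeas T 1 => ulim (m @ p) (fun mu : fmeas S D => meas_int (val nu) (comb k (val mu)))) - c| <= d / 8 + d / 8.
    by rewrite ler_distl => /andP[_].
  apply: ulim_dist => //; first exact: bza.
  apply: nearW => nu; rewrite -[X in _ - X](ulim_cst (m @ p)).
  apply: ulim_dist; [exact: bcomb|by exists (`|meas_int (val nu) z|)|].
  change (p [set a | `|meas_int (val nu) (comb k (val (m a))) - meas_int (val nu) z| <= d / 8 + d / 8]).
  have /cvgrPdist_le/(_ _ d8) pnu : meas_int (val nu) a @[a --> p] --> meas_int (val nu) z.
    exact: meas_int_cvg.
  apply: filterS (filterI pA pnu) => a [Aa /= az].
  rewrite (le_trans (ler_distD (meas_int (val nu) a) _ _))// lerD//.
    exact: near_a.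
  by rewrite distrC.
rewrite eq_dl in lower; have := le_trans lower upper; lra.
Qed.

End PointwiseToUniform.

(** * The interpolation space *)

Record unit_kernel (R : realType) (S T : Type) := UnitKernel {
  kernel_fun :> S -> T -> R;
  kernel_le1 : forall s t, `|kernel_fun s t| <= 1 }.

Section InterpolationNorm.
Context {R : realType} {S T : Type} (k : unit_kernel R S T).
Implicit Types (z w : T -> R) (e : R).

Definition finite_energy z : Prop := bounded_func z /\ exists2 C, 0 <= C & Nle k C z.

(** The supremum is only meaningful for functions of finite energy. *)
Definition dfjp_norm z : R :=
  Num.sqrt (sup (range (fun n => \sum_(0 <= i < n) K k i z ^+ 2))).

Lemma has_sup_energy z : finite_energy z ->
  has_sup (range (fun n => \sum_(0 <= i < n) K k i z ^+ 2)).
Proof.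
move=> [_ [C C0 zC]]; split; first by exists (\sum_(0 <= i < 0) K k i z ^+ 2), 0%N.
by exists (C ^+ 2) => _ [n _ <-]; exact: zC.
Qed.

Lemma dfjp_norm_ge0 z : 0 <= dfjp_norm z.
Proof. exact: sqrtr_ge0. Qed.

Lemma dfjp_norm_le e z : 0 <= e -> Nle k e z -> dfjp_norm z <= e.
Proof.
move=> e0 ze; rewrite -[leRHS]ger0_norm// -sqrtr_sqr.
by apply: ler_wsqrtr; apply: ge_sup => [|_ [n _ <-]]; [exists (\sum_(0 <= i < 0) K k i z ^+ 2), 0%N|exact: ze].
Qed.

Lemma Nle_dfjp_norm z : finite_energy z -> Nle k (dfjp_norm z) z.
Proof.
move=> zf n; have sz := has_sup_energy zf.
have H m : \sum_(0 <= i < m) K k i z ^+ 2 <=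
    sup (range (fun n => \sum_(0 <= i < n) K k i z ^+ 2)).
  by apply: sup_upper_bound => //; exists m.
by rewrite sqr_sqrtr// (le_trans _ (H 0%N))// big_nil.
Qed.

Lemma finite_energyD z w : finite_energy z -> finite_energy w -> finite_energy (z + w).
Proof.
move=> [zb [C C0 zC]] [wb [D D0 wD]]; split; first exact: bounded_funcD.
by exists (C + D); [exact: addr_ge0|exact: NleD].
Qed.

Lemma finite_energyZ (c : R) z : finite_energy z -> finite_energy (c *: z).
Proof.
move=> [zb [C C0 zC]]; split; first exact: bounded_funcZ.
by exists (`|c| * C); [exact: mulr_ge0|exact: NleZ].
Qed.

Lemma finite_energy_comb mu : finite_energy (comb k mu).
Proof.
split; first exact/bounded_comb/kernel_le1.
exists (2 * mass mu); first by rewrite mulr_ge0// mass_ge0.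
exact/Nle_comb_mass/kernel_le1.
Qed.

Lemma dfjp_normD z w : finite_energy z -> finite_energy w ->
  dfjp_norm (z + w) <= dfjp_norm z + dfjp_norm w.
Proof.
move=> zf wf; apply: dfjp_norm_le; first by rewrite addr_ge0// dfjp_norm_ge0.
by apply: NleD; rewrite ?dfjp_norm_ge0//; [exact: zf.1|exact: wf.1|exact: Nle_dfjp_norm..].
Qed.

Lemma dfjp_normZ (c : R) z : finite_energy z -> dfjp_norm (c *: z) = `|c| * dfjp_norm z.
Proof.
move=> zf.
have le (d : R) w : finite_energy w -> dfjp_norm (d *: w) <= `|d| * dfjp_norm w.
  move=> wf; apply: dfjp_norm_le; first by rewrite mulr_ge0// dfjp_norm_ge0.
  by apply: NleZ; [exact: wf.1|exact: Nle_dfjp_norm].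
apply/eqP; rewrite eq_le le//=.
have [->|c0] := eqVneq c 0; first by rewrite normr0 mul0r dfjp_norm_ge0.
have cgt : 0 < `|c| by rewrite normr_gt0.
rewrite -ler_pdivlMl//.
have := le c^-1 (c *: z) (finite_energyZ c zf).
by rewrite scalerA mulVf// scale1r normfV.
Qed.

Lemma dfjp_norm_sup z t : finite_energy z -> `|z t| <= dfjp_norm z.
Proof.
by move=> zf; apply: (Nle_sup (kernel_le1 k)); [exact: dfjp_norm_ge0|exact: zf.1|exact: Nle_dfjp_norm].
Qed.

(** The closed span of the functions k s for the interpolation norm. Taking this
  span makes the separability of the space a property of k. *)
Definition dfjp : set (T -> R) := [set z | bounded_func z /\
  forall e, 0 < e -> exists mu, Nle k e (z - comb k mu)].

Lemma dfjp_finite z : dfjp z -> finite_energy z.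
Proof.
move=> [zb /(_ 1 ltr01)[mu zmu]].
rewrite -[z](subrK (comb k mu)); apply: finite_energyD; last exact: finite_energy_comb.
split; last by exists 1.
exact/bounded_funcB/bounded_comb/kernel_le1.
Qed.

Lemma dfjp_comb mu : dfjp (comb k mu).
Proof.
split; first exact: (finite_energy_comb mu).1.
move=> e e0; exists mu; rewrite subrr => n.
rewrite big1 ?sqr_ge0// => i _.
have := @K_le_sup _ _ _ k i 0 0 (lexx 0); rewrite mulr0 => K0.
have : K k i 0 <= 0 by apply: K0 => t; rewrite normr0.
by move=> /(conj (K_ge0 k i 0))/andP/le_anti <-; rewrite expr0n.
Qed.

Lemma dfjp_closed z : bounded_func z ->
  (forall e, 0 < e -> exists2 w, dfjp w & Nle k e (z - w)) -> dfjp z.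
Proof.
move=> zb H; split => // e e0; have e2 : 0 < e / 2 by rewrite divr_gt0.
have [w [wb /(_ _ e2)[mu wmu]] zw] := H _ e2; exists mu.
rewrite (_ : z - comb k mu = (z - w) + (w - comb k mu)); last by rewrite addrA subrK.
rewrite (splitr e); apply: NleD => //; [exact: ltW|exact: ltW|exact: bounded_funcB|].
exact/bounded_funcB/bounded_comb/kernel_le1.
Qed.

Lemma dfjp_lin (a : R) z w : dfjp z -> dfjp w -> dfjp (a *: z + w).
Proof.
move=> zE wE; have [zb zH] := zE; have [wb wH] := wE.
split; first by apply: bounded_funcD => //; exact: bounded_funcZ.
move=> e e0; have e2 : 0 < e / 2 by rewrite divr_gt0.
have e2a : 0 < e / 2 / (`|a| + 1) by rewrite divr_gt0// ltr_wpDl.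
have [mu zmu] := zH _ e2a; have [nu wnu] := wH _ e2.
exists (scalem a mu ++ nu).
have -> : a *: z + w - comb k (scalem a mu ++ nu) = a *: (z - comb k mu) + (w - comb k nu).
  by rewrite comb_cat combZ scalerBr opprD addrACA.
have b1 := bounded_funcB zb (bounded_comb (kernel_le1 k) mu).
have b2 := bounded_funcB wb (bounded_comb (kernel_le1 k) nu).
rewrite (splitr e); apply: NleD; rewrite ?(ltW e2)//; first exact: bounded_funcZ.
apply: Nle_le (NleZ a b1 zmu); first by rewrite mulr_ge0// ltW.
rewrite mulrCA ler_piMr ?(ltW e2)// ler_pdivrMr ?ltr_wpDl// mul1r.
by rewrite lerDl.
Qed.

Definition dfjp_pred : {pred T -> R} := mem dfjp.

Lemma dfjp_submod_closed : submod_closed dfjp_pred.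
Proof.
split; first by apply/mem_set; rewrite -(comb_nil k); exact: dfjp_comb.
by move=> a z w /set_mem zE /set_mem wE; apply/mem_set; exact: dfjp_lin.
Qed.

HB.instance Definition _ := GRing.isSubmodClosed.Build R (T -> R) dfjp_pred
  dfjp_submod_closed.

Definition dfjp_space : Type := {z : T -> R | z \in dfjp_pred}.

HB.instance Definition _ := SubChoice.on dfjp_space.
HB.instance Definition _ := [SubChoice_isSubLmodule of dfjp_space by <:].

Lemma dfjpP (x : dfjp_space) : dfjp (\val x).
Proof. exact: set_mem (valP x). Qed.

Definition to_dfjp z (zE : dfjp z) : dfjp_space := 
  exist (fun z => z \in dfjp_pred) z (mem_set zE).

Lemma dfjp_space_ext (x y : dfjp_space) : \val x = \val y -> x = y.
Proof. exact: val_inj. Qed.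

Lemma dfjp_space_finite (x : dfjp_space) : finite_energy (\val x).
Proof. exact/dfjp_finite/dfjpP. Qed.

Let snorm (x : dfjp_space) : R := dfjp_norm (\val x).

Let ler_snormD x y : snorm (x + y) <= snorm x + snorm y.
Proof. exact/dfjp_normD/dfjp_space_finite/dfjp_space_finite. Qed.

Let snormZ (a : R) x : snorm (a *: x) = `|a| * snorm x.
Proof. exact/dfjp_normZ/dfjp_space_finite. Qed.

Let snorm0 x : snorm x = 0 -> x = 0.
Proof.
move=> x0; apply: dfjp_space_ext; apply/funext => t.
have := dfjp_norm_sup t (dfjp_space_finite x); rewrite -/(snorm x) x0.
by rewrite normr_le0 => /eqP.
Qed.

HB.instance Definition _ := Lmodule_isNormed.Build R dfjp_space
  ler_snormD snormZ snorm0.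

Lemma dfjp_space_normE (x : dfjp_space) : `|x| = dfjp_norm (\val x).
Proof. by []. Qed.

Lemma dfjp_space_normP (x : dfjp_space) e : 0 <= e -> `|x| <= e <-> Nle k e (\val x).
Proof.
move=> e0; split; last exact: dfjp_norm_le.
rewrite dfjp_space_normE => xe; apply: Nle_le xe _; first exact: dfjp_norm_ge0.
exact/Nle_dfjp_norm/dfjp_space_finite.
Qed.

Lemma dfjp_space_sup (x : dfjp_space) t : `|\val x t| <= `|x|.
Proof. exact/dfjp_norm_sup/dfjp_space_finite. Qed.

(** A Cauchy filter converges uniformly, and its energy bounds pass to the uniform
  limit by Nle_near. *)
Let dfjp_space_complete (F : set_system dfjp_space) : ProperFilter F ->
  cauchy F -> cvg F.
Proof.
move=> FF /cauchyP Fc.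
have zex t : exists r : R, (fun y : dfjp_space => \val y t) @ F --> r.
  apply/cvg_ex/cauchy_cvgP/cauchyP => e e0; have [x Fx] := Fc e e0.
  exists (\val x t).
  change (F [set y : dfjp_space | ball (\val x t) e (\val y t)]).
  apply: filterS Fx => y; rewrite -!ball_normE /=.
  exact: le_lt_trans (dfjp_space_sup (x - y) t).
have /choice[z Fz] := zex.
have unif e x : F (ball x e) -> forall y, `|x - y| < e ->
    forall t, `|z t - \val y t| <= e + e.
  move=> Fx y xy t.
  have : `|\val y' t - \val y t| @[y' --> F] --> `|z t - \val y t|.
    by apply: cvg_norm; apply: cvgB; [exact: Fz|exact: cvg_cst].
  move=> /cvgr_to_le; apply; apply: filterS Fx => y'; rewrite -ball_normE /= => xy'.
  apply: le_trans (dfjp_space_sup (y' - y) t) _.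
  by rewrite (le_trans (ler_distD x _ _))// (distrC y') lerD// ltW.
have zb : bounded_func z.
  have [x Fx] := Fc 1 ltr01; have xx : `|x - x| < 1 by rewrite subrr normr0.
  have [C xC] := (dfjpP x).1; exists (1 + 1 + C) => t.
  rewrite -[z t](subrK (\val x t)) (le_trans (ler_normD _ _))// lerD//.
  exact: unif xx t.
have energy e x : 0 < e -> F (ball x e) -> Nle k e (z - \val x).
  move=> e0 Fx; apply: Nle_near => [||d d0]; [exact: ltW| |].
    exact/bounded_funcB/(dfjpP x).1.
  have d2 : 0 < d / 2 by rewrite divr_gt0.
  have [x' Fx'] := Fc _ d2.
  have [y []] := near_ex2 Fx Fx'; rewrite -!ball_normE /= => xy x'y.
  exists (\val (y - x)); split; first exact: (dfjpP _).1.
    by apply/dfjp_space_normP; rewrite ?ltW// distrC.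
  move=> t; rewrite (_ : _ - _ = z t - \val y t); last first.
    have -> : \val (y - x) = \val y - \val x by [].
    by rewrite !fctE; ring.
  by rewrite (splitr d); exact: unif x'y t.
have zE : dfjp z.
  apply: dfjp_closed => // e e0; have [x Fx] := Fc e e0.
  by exists (\val x); [exact: dfjpP|exact: energy].
apply/cvg_ex; exists (to_dfjp zE); apply/cvgrPdist_le => e e0.
have e2 : 0 < e / 2 by rewrite divr_gt0.
have [x Fx] := Fc _ e2; have zx := energy _ _ e2 Fx.
apply: filterS Fx => y; rewrite -ball_normE /= => xy.
rewrite (le_trans (ler_distD x _ _))// (splitr e) lerD ?(ltW xy)//.
by apply/dfjp_space_normP => //; exact: ltW.
Qed.

HB.instance Definition _ := Uniform_isComplete.Build dfjp_space dfjp_space_complete.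

End InterpolationNorm.

(** * Reflexivity and separability *)

Lemma NleC (R : realType) (S T : Type) (k : S -> T -> R) (e : R) (z w : T -> R) :
  bounded_func z -> bounded_func w -> Nle k e (z - w) -> Nle k e (w - z).
Proof.
move=> zb wb /(NleZ (-1) (bounded_funcB zb wb)).
by rewrite normrN1 mul1r scaleN1r opprB.
Qed.

Section DFJPReflexive.
Context {R : realType} {S T : Type} (k : unit_kernel R S T).
Implicit Types (x y : dfjp_space k).
Hypothesis k_dl : forall C D : R,
  double_limits (fun (mu : fmeas S C) (nu : fmeas T D) =>
    meas_int (val mu) (fun s => meas_int (val nu) (k s))).

Lemma dual_eval t : dual (fun x : dfjp_space k => \val x t).
Proof.
by apply: dual_contraction => [a x y //|x]; exact: dfjp_space_sup.
Qed.

(** By Goldstine's theorem, phi is a weak limit of elements of a ball; its values on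
  the evaluations form a function z, the pointwise limit of these elements. For
  each functional f, the elements x of the ball such that f x is close to phi f
  form a convex set, which approximates z pointwise, hence uniformly by
  pointwise_to_uniform, hence in norm by convex_sup_to_Nle. So z belongs to the
  space, and f z is as close to phi f as required. *)
Lemma dfjp_reflexive : reflexive_space (dfjp_space k).
Proof.
move=> phi [phi_lin [M phi_le]].
have [p pU [pM pphi]] := goldstine phi_lin phi_le.
pose z t := phi (fun x : dfjp_space k => \val x t).
pose v (x : dfjp_space k) : T -> R := \val x.
have vpU : UltraFilter (v @ p) := ultra_fmap v pU.
have pz t : a t @[a --> v @ p] --> z t.
  apply/cvgrPdist_le => e e0.
  change (p [set x | `|z t - \val x t| <= e]).
  by apply: filterS (pphi _ (dual_eval t) _ e0) => x; rewrite distrC.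
pose A f d : set (T -> R) :=
  v @` [set x : dfjp_space k | `|x| <= `|M| /\ `|f x - phi f| <= d].
have pA f d : dual f -> 0 < d -> (v @ p) (A f d).
  move=> df d0; change (p (v @^-1` A f d)).
  by apply: filterS (filterI pM (pphi _ df _ d0)) => x [xM xf]; exists x.
have Aconv f d : dual f -> is_convex (A f d).
  move=> df _ _ t [x [xM xf] <-] [y [yM yf] <-] /andP[t0 t1].
  have t1' : 0 <= 1 - t by rewrite subr_ge0.
  have le (a b c : R) : a <= c -> b <= c -> (1 - t) * a + t * b <= c.
    move=> ac bc; apply: le_trans (lerD (ler_wpM2l t1' ac) (ler_wpM2l t0 bc)) _.
    by rewrite -mulrDl subrK mul1r.
  exists ((1 - t) *: x + t *: y) => //; split.
    rewrite (le_trans (ler_normD _ _))// !normrZ (ger0_norm t0) (ger0_norm t1').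
    exact: le.
  rewrite (df.1 (1 - t)) (dualZ _ _ df).
  rewrite (_ : _ - _ = (1 - t) * (f x - phi f) + t * (f y - phi f)); last by ring.
  rewrite (le_trans (ler_normD _ _))// !normrM (ger0_norm t0) (ger0_norm t1').
  exact: le.
have AM f d a : A f d a -> bounded_func a /\ Nle k `|M| a.
  move=> [x [xM _] <-]; split; first exact: (dfjpP x).1.
  exact/dfjp_space_normP.
have Aunif f d : dual f -> 0 < d -> forall e : R, 0 < e ->
    exists2 a, A f d a & forall t, `|a t - z t| <= e.
  move=> df d0; apply: (@pointwise_to_uniform _ _ _ k _ k_dl (v @ p) (A f d) z `|M|) => //.
  - exact: kernel_le1.
  - exact: pA.
  - exact: Aconv.
  - exact: AM.
have dz := @dual_zero R (dfjp_space k).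
have zb : bounded_func z.
  have [a /AM[[C aC] _] az] := Aunif _ 1 dz ltr01 1 ltr01.
  exists (1 + C) => t; rewrite -[z t](subrK (a t)) (le_trans (ler_normD _ _))//.
  by rewrite lerD// distrC.
have zM : Nle k `|M| z.
  apply: Nle_near => // e e0.
  have [a /AM[ba aM] az] := Aunif _ 1 dz ltr01 e e0.
  by exists a; split => // t; rewrite distrC.
have AzM f d a : A f d a -> bounded_func a /\ Nle k (`|M| + `|M|) (a - z).
  move=> /AM[ba aM]; split => //; apply: NleD => //.
    by rewrite -scaleN1r; exact: bounded_funcZ.
  by have := NleZ (-1) zb zM; rewrite normrN1 mul1r scaleN1r.
have Anorm f d : dual f -> 0 < d -> forall e : R, 0 < e ->
    exists2 a, A f d a & Nle k e (a - z).
  move=> df d0; apply: (convex_sup_to_Nle (Aconv _ _ df) zb); first exact: AzM.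
  exact: Aunif.
have zE : dfjp k z.
  apply: dfjp_closed => // e e0.
  have [_ [x _ <-] xz] := Anorm _ 1 dz ltr01 e e0.
  exists (\val x); first exact: dfjpP.
  by apply: NleC => //; exact: (dfjpP x).1.
exists (to_dfjp zE) => f df; apply/eqP.
rewrite -subr_eq0 -normr_le0; apply/ler_addgt0Pl => e e0; rewrite addr0.
have e2 : 0 < e / 2 by rewrite divr_gt0.
have nf := dual_norm_ge0 df.
have e2f : 0 < e / 2 / (dual_norm f + 1) by rewrite divr_gt0// ltr_wpDl.
have [_ [x [_ xf] <-] xz] := Anorm _ _ df e2 _ e2f.
have {}xz : `|x - to_dfjp zE| <= e / 2 / (dual_norm f + 1).
  by apply/dfjp_space_normP => //; exact: ltW.
rewrite (le_trans (ler_distD (f x) _ _))// (splitr e) lerD//; first by rewrite distrC.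
rewrite -(dualB _ _ df) (le_trans (dual_le _ df))//.
rewrite (le_trans (ler_wpM2l nf xz))// mulrCA ler_piMr ?(ltW e2)//.
by rewrite ler_pdivrMr ?ltr_wpDl// mul1r lerDl.
Qed.

End DFJPReflexive.

Section DFJPSeparable.
Context {R : realType} {S T : Type} (k : unit_kernel R S T).

Lemma comb1 (c : R) s t : comb k [:: (c, s)] t = c * k s t.
Proof. by rewrite /comb /meas_int big_seq1. Qed.

(** Combinations with rational coefficients of the functions k (d i) are dense. *)
Lemma dfjp_separable : kernel_separable (fun t s => k s t) ->
  separable_space (dfjp_space k).
Proof.
move=> [d kd].
pose rc (l : seq (rat * nat)) : seq (R * S) := [seq (ratr a.1, d a.2) | a <- l].
pose D := range (fun l => to_dfjp (dfjp_comb k (rc l))).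
have bcomb := bounded_comb (kernel_le1 k).
have approx1 (c : R) s e : 0 < e -> exists b : rat * nat,
    Nle k e (comb k [:: (c, s)] - comb k (rc [:: b])).
  move=> e0.
  (* the bound of Nle_comb, for a mass at most 2 |c| + 1 *)
  pose C := e ^+ 2 / (2 * (2 * `|c| + 1)).
  have c2 : 0 < 2 * `|c| + 1 by rewrite ltr_wpDl// mulr_ge0.
  have C0 : 0 < C by rewrite divr_gt0 ?exprn_gt0// mulr_gt0.
  have C2 : 0 < C / 2 by rewrite divr_gt0.
  have C1 : 0 < C / 2 / (`|c| + 1) by apply: divr_gt0 => //; rewrite ltr_wpDl.
  have [i Hi] := kd s _ C1.
  have m0 : c < c + Num.min 1 (C / 2) by rewrite ltrDl lt_min ltr01.
  have [q] := rat_in_itvoo m0; rewrite in_itv /= => /andP[cq].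
  rewrite -ltrBlDl lt_min => /andP[qc1 qC2]; exists (q, i); set r : R := ratr q in cq qc1 qC2.
  have cr : `|c - r| <= C / 2 by rewrite ler_norml; lra.
  have eqmu : comb k [:: (c, s)] - comb k (rc [:: (q, i)]) = comb k [:: (c, s); (- r, d i)].
    by rewrite (comb_cat _ [:: (c, s)] [:: (- r, d i)]); congr (_ + _);
      apply/funext => t; rewrite fctE !comb1 mulNr.
  rewrite eqmu; apply: (@Nle_comb _ _ _ k _ C) => [t||]; last 2 first.
  - exact: ltW.
  - have rle : `|r| <= `|c| + 1.
      have := ler_norm c; have := ler_norm (- c); rewrite normrN ler_norml; lra.
    rewrite /mass !big_cons big_nil addr0 /= normrN.
    apply: (@le_trans _ _ (2 * (2 * `|c| + 1) * C)).
      by rewrite ler_wpM2r ?(ltW C0)// ler_pM2l//; lra.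
    by rewrite /C mulrC divfK// mulf_neq0// gt_eqF.
  - rewrite -eqmu !fctE !comb1 -/r.
    rewrite (_ : _ - _ = c * (k s t - k (d i) t) + (c - r) * k (d i) t); last by ring.
    rewrite (le_trans (ler_normD _ _))// (splitr C) lerD//.
      rewrite normrM (le_trans (ler_wpM2l (normr_ge0 c) (Hi t)))//.
      rewrite mulrCA ler_piMr ?(ltW C2)// ler_pdivrMr ?ltr_wpDl// mul1r.
      by rewrite lerDl.
    by rewrite normrM -[leRHS]mulr1 ler_pM// kernel_le1.
have approx (mu : seq (R * S)) : forall e, 0 < e -> exists l, Nle k e (comb k mu - comb k (rc l)).
  elim: mu => [|[c s] mu IH] e e0.
    exists [::]; rewrite subrr -(comb_nil k).
    apply: (@Nle_comb _ _ _ k _ 0) => // [t|].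
      by rewrite comb_nil normr0.
    by rewrite mulr0 sqr_ge0.
  have e2 : 0 < e / 2 by rewrite divr_gt0.
  have [b Hb] := approx1 c s _ e2; have [l Hl] := IH _ e2.
  exists (b :: l).
  have -> : comb k ((c, s) :: mu) - comb k (rc (b :: l)) =
      (comb k [:: (c, s)] - comb k (rc [:: b])) + (comb k mu - comb k (rc l)).
    rewrite (comb_cat k [:: (c, s)] mu) [rc (b :: l)](_ : _ = rc [:: b] ++ rc l)//.
    by rewrite comb_cat opprD addrACA.
  by rewrite (splitr e); apply: NleD; rewrite ?(ltW e2)//; exact: bounded_funcB.
exists D.
  by apply: sub_countable (card_image_le _ _) _; exact: countableP.
move=> O [x Ox] Oop.
have /nbhs_ballP[e /= e0 eO] := open_nbhs_nbhs (conj Oop Ox).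
have e4 : 0 < e / 4 by rewrite divr_gt0.
have [xb /(_ _ e4)[mu xmu]] := dfjpP x.
have [l mul] := approx mu _ e4.
exists (to_dfjp (dfjp_comb k (rc l))); split; last by exists l.
apply: eO; rewrite -ball_normE /=.
have : `|x - to_dfjp (dfjp_comb k (rc l))| <= e / 4 + e / 4.
  apply/dfjp_space_normP; first by rewrite addr_ge0// ltW.
  rewrite (_ : \val _ = (\val x - comb k mu) + (comb k mu - comb k (rc l))).
    by apply: NleD; rewrite ?(ltW e4)//; exact: bounded_funcB.
  by rewrite addrA subrK.
by move=> /le_lt_trans; apply; lra.
Qed.

End DFJPSeparable.

(** * The strong operator topology *)

Section StrongOperatorTopology.
Context {R : realType} {E : normedModType R}.
Implicit Types (u w : isometry_group E) (v : E).

Lemma isometry_eval_continuous v :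
  continuous (fun w : isometry_group E => isometry_fun w v).
Proof.
move=> u; apply: (@continuous_comp (isometry_group E) {ptws E -> E} E
  (fun w => \val w) (fun h => h v)).
  exact: (@initial_continuous _ _ (set_val : @linear_isometries R E -> {ptws E -> E})).
exact: (@proj_continuous E (fun=> E) v).
Qed.

Lemma nbhs_isometry u v (e : R) : 0 < e ->
  nbhs u [set w | `|isometry_fun u v - isometry_fun w v| < e].
Proof.
move=> e0; have /cvgrPdist_lt/(_ _ e0) := @isometry_eval_continuous v u.
by [].
Qed.

Lemma continuous_isometry (X : topologicalType) (T : X -> isometry_group E) :
  (forall v, continuous (fun x => isometry_fun (T x) v)) -> continuous T.
Proof.
move=> Tc; apply: (@continuous_comp_initial _ _ _ (set_val : @linear_isometries R E -> {ptws E -> E})).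
move=> x; apply/pointwise_cvgP => v; exact: Tc.
Qed.

End StrongOperatorTopology.

(** * Translations *)

Section Precomposition.
Context {R : realType} {S T : Type} (k : unit_kernel R S T).
Variables (sg : S -> S) (tau : T -> T).
Hypothesis k_equiv : forall s t, k s (tau t) = k (sg s) t.

Definition push_meas (mu : seq (R * S)) := [seq (a.1, sg a.2) | a <- mu].

Lemma mass_push mu : mass (push_meas mu) = mass mu.
Proof. by rewrite /mass big_map. Qed.

Lemma comb_push mu : comb k mu \o tau = comb k (push_meas mu).
Proof.
apply/funext => t /=; rewrite /comb /meas_int big_map; apply: eq_bigr => a _.
by rewrite k_equiv.
Qed.

Lemma K_precomp n (z : T -> R) : bounded_func z -> K k n (z \o tau) <= K k n z.
Proof.
move=> zb; apply: lb_le_inf; first exact: (has_inf_K k n zb).1.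
move=> _ [mu [C [C0 zC ->]]]; rewrite -(mass_push mu).
apply: K_le => // t; rewrite -comb_push; exact: zC.
Qed.

Lemma Nle_precomp e z : bounded_func z -> Nle k e z -> Nle k e (z \o tau).
Proof.
move=> zb ze n; apply: le_trans (ze n); apply: ler_sum => i _.
by rewrite ler_pXn2r ?nnegrE ?K_ge0// K_precomp.
Qed.

Lemma dfjp_precomp z : dfjp k z -> dfjp k (z \o tau).
Proof.
move=> [zb zE]; split; first by have [C zC] := zb; exists C => t; exact: zC.
move=> e /zE[mu zmu]; exists (push_meas mu); rewrite -comb_push.
apply: (Nle_precomp (z := z - comb k mu)) => //.
exact/bounded_funcB/bounded_comb/kernel_le1.
Qed.

End Precomposition.

Section Translations.
Context {R : realType} {X : normedModType R}.
Implicit Types (a b s t : X).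

Definition norm_kernel : unit_kernel R X X.
Proof.
by exists ker => s t; rewrite gtr0_norm ?ker_gt0// ker_le1.
Defined.
Local Notation E := (dfjp_space norm_kernel).

Lemma ker_shift a s t : norm_kernel s (t + a) = norm_kernel (s + a) t.
Proof. by rewrite /= /ker (addrC t) addrA. Qed.

Definition translate a (x : E) : E :=
  to_dfjp (dfjp_precomp (ker_shift a) (dfjpP x)).

Lemma translateE a x t : \val (translate a x) t = \val x (t + a).
Proof. by []. Qed.

Lemma translateD a b x : translate (a + b) x = translate a (translate b x).
Proof.
apply: dfjp_space_ext; apply/funext => t; rewrite !translateE.
by rewrite addrA.
Qed.

Lemma translate0 x : translate 0 x = x.
Proof. by apply: dfjp_space_ext; apply/funext => t; rewrite translateE addr0. Qed.

Lemma translate_linear a : linear (translate a).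
Proof. by move=> c x y; apply: dfjp_space_ext; apply/funext => t. Qed.

Lemma translate_norm a x : `|translate a x| = `|x|.
Proof.
have le b y : `|translate b y| <= `|y|.
  apply/dfjp_space_normP => //; apply: (Nle_precomp (ker_shift b) (dfjpP y).1).
  exact/dfjp_space_normP.
apply/eqP; rewrite eq_le le /=.
by have := le (- a) (translate a x); rewrite -translateD addNr translate0.
Qed.

Lemma translate_isometry a : (translate a : {ptws E -> E}) \in @linear_isometries R E.
Proof.
apply/mem_set; split; [exact: translate_linear|exact: translate_norm|].
move=> x _; exists (translate (- a) x) => //.
by rewrite -translateD subrr translate0.
Qed.

Definition translation a : isometry_group E := SigSub (translate_isometry a).

Lemma translationE a x : isometry_fun (translation a) x = translate a x.
Proof. by []. Qed.

Lemma translationD a b : translation (a + b) = (translation a * translation b)%g.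
Proof. by apply: isometry_group_ext => x; exact: translateD. Qed.

Lemma translation0 : translation 0 = 1%g.
Proof. by apply: isometry_group_ext => x; exact: translate0. Qed.

Lemma translationV a : (translation a)^-1%g = translation (- a).
Proof.
have /(congr1 (fun u => (translation a)^-1 * u)%g) := translationD a (- a).
by rewrite subrr translation0 mulg1 mulgA mulVg mul1g.
Qed.

(** It is enough to treat a combination y of functions ker s. The differences of its
  translates have bounded mass, so Nle_comb controls them by their supremum, which
  is small since ker is a contraction in each variable. *)
Lemma translate_uniform x (e : R) : 0 < e -> exists2 d, 0 < d &
  forall a b, `|a - b| < d -> `|translate a x - translate b x| <= e.
Proof.
move=> e0; have e4 : 0 < e / 4 by rewrite divr_gt0.
have [xb /(_ _ e4)[mu xmu]] := dfjpP x.
set y : E := to_dfjp (dfjp_comb norm_kernel mu).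
have {}xmu : `|x - y| <= e / 4 by apply/dfjp_space_normP => //; exact: ltW.
have m1 : 0 < 4 * (mass mu + 1) ^+ 2.
  by rewrite mulr_gt0// exprn_gt0// ltr_wpDl// mass_ge0.
pose d := (e / 2) ^+ 2 / (4 * (mass mu + 1) ^+ 2).
have d0 : 0 < d by rewrite divr_gt0// exprn_gt0// divr_gt0.
exists d => // a b abd.
have mud : `|translate a y - translate b y| <= e / 2.
  apply/dfjp_space_normP; first by rewrite divr_ge0// ltW.
  pose nu := push_meas (fun s => s + a) mu ++
             scalem (-1) (push_meas (fun s => s + b) mu).
  have eq_nu : \val (translate a y - translate b y) = comb norm_kernel nu.
    by rewrite comb_cat combZ scaleN1r -(comb_push (ker_shift a)) -(comb_push (ker_shift b)).
  rewrite eq_nu; apply: (@Nle_comb _ _ _ norm_kernel nu (mass mu * d)).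
  - move=> t; rewrite -eq_nu.
    rewrite -[\val _ t]/(comb norm_kernel mu (t + a) - comb norm_kernel mu (t + b)).
    rewrite /comb -meas_intB; apply: meas_int_bound => s; apply: le_trans (ker_lip _ _ _) _.
    by rewrite opprD addrACA subrr add0r ltW.
  - by rewrite mulr_ge0 ?mass_ge0// ltW.
  rewrite mass_cat massZ !mass_push normrN1 mul1r.
  rewrite (_ : 2 * _ * _ = 4 * mass mu ^+ 2 * d); last by ring.
  apply: (@le_trans _ _ (4 * (mass mu + 1) ^+ 2 * d)).
    rewrite ler_wpM2r ?(ltW d0)// ler_pM2l// ler_pXn2r ?nnegrE ?addr_ge0 ?mass_ge0//.
    by rewrite lerDl.
  by rewrite /d mulrC divfK// gt_eqF.
have -> : translate a x - translate b x =
    (translate a (x - y) - translate b (x - y)) + (translate a y - translate b y).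
  apply: dfjp_space_ext; apply/funext => t.
  change (\val x (t + a) - \val x (t + b) =
    ((\val x (t + a) - \val y (t + a)) - (\val x (t + b) - \val y (t + b))) +
    (\val y (t + a) - \val y (t + b))); ring.
rewrite (le_trans (ler_normD _ _))// (splitr e) lerD//.
rewrite (le_trans (ler_normB _ _))// !translate_norm.
by rewrite (_ : e / 2 = e / 4 + e / 4) ?lerD//; field.
Qed.

(** The function ker 0, whose translates are the functions ker a. *)
Definition base_point : E := to_dfjp (dfjp_comb norm_kernel [:: (1, 0)]).

Lemma translate_base a t : \val (translate a base_point) t = ker a t.
Proof. by rewrite -[LHS]/(comb norm_kernel [:: (1, 0)] (t + a)) comb1 mul1r ker_shift add0r. Qed.

(** At - b, the function ker a takes the value (1 + |a - b|)^-1, and ker b the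
  value 1. *)
Lemma translate_base_dist a b (e : R) : e <= 1 / 2 ->
  `|translate a base_point - translate b base_point| <= e -> `|a - b| <= 2 * e.
Proof.
move=> e2 /(le_trans (dfjp_space_sup _ (- b))).
rewrite -[\val _ _]/(\val (translate a base_point) (- b) - \val (translate b base_point) (- b)).
rewrite !translate_base {2}/ker subrr normr0 addr0 invr1 distrC => H.
have {}H : 1 - ker a (- b) <= e by apply: le_trans H; exact: ler_norm.
rewrite ker_norm; have k0 := ker_gt0 a (- b).
have k2 : 1 / 2 <= ker a (- b) by lra.
have : (ker a (- b))^-1 <= 2.
  by rewrite -[leRHS]invrK lef_pV2 ?posrE ?invr_gt0// -[leLHS]mul1r.
have : (ker a (- b))^-1 * ker a (- b) = 1 by rewrite mulVf// gt_eqF.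
have := ker_le1 a (- b).
have : 0 < (ker a (- b))^-1 by rewrite invr_gt0.
move: (ker a (- b)) (ker a (- b))^-1 H => x y; nra.
Qed.

Lemma translation_inj : injective translation.
Proof.
move=> a b ab; have := @translate_base_dist a b 0.
rewrite -!translationE ab subrr normr0 mulr0 => /(_ _ (lexx 0)).
rewrite normr_le0 subr_eq0 => H; apply/eqP/H; lra.
Qed.

Lemma translation_continuous : continuous translation.
Proof.
apply: continuous_isometry => x a; apply/cvgrPdist_le => e e0.
have [d d0 Hd] := translate_uniform x e0.
apply/nbhs_ballP; exists d => //= b; rewrite -ball_normE /=; exact: Hd.
Qed.

End Translations.

(** * The group of translations is closed *)

Section ClosedOrbit.
Context {R : realType} {X : completeNormedModType R}.
Local Notation E := (dfjp_space (@norm_kernel R X)).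
Implicit Types (u w : isometry_group E).

(** If u is in the closure of the group of translations, the points a at which
  translate a base_point is close to u base_point form a Cauchy filter; its limit
  a0 satisfies translate a0 = u, because every neighbourhood of u contains a
  translation by a point close to a0. *)
Lemma closed_translations : closed (range (@translation R X)).
Proof.
move=> u clu.
have near_u (v : E) (e : R) : 0 < e -> exists a : X,
    `|isometry_fun u base_point - translate a base_point| < e /\
    `|isometry_fun u v - translate a v| < e.
  move=> e0; have [_ [[a _ <-] [H1 H2]]] :=
    clu _ (filterI (nbhs_isometry u base_point e0) (nbhs_isometry u v e0)).
  by exists a.
pose F := filter_from [set e : R | 0 < e]
  (fun e => [set a : X | `|isometry_fun u base_point - translate a base_point| < e]).
have FF : ProperFilter F.
  apply: filter_from_proper => [|e e0]; last first.
    by have [a [au _]] := near_u base_point e e0; exists a.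
  apply: filter_from_filter; first by exists 1 => /=.
  move=> e d /= e0 d0; exists (Num.min e d); first by rewrite /= lt_min e0.
  by move=> a; rewrite /= lt_min => /andP.
have close (e : R) a b : e <= 1 / 4 ->
    `|isometry_fun u base_point - translate a base_point| < e ->
    `|isometry_fun u base_point - translate b base_point| < e ->
    `|a - b| <= 4 * e.
  move=> e4 ua ub; have -> : 4 * e = 2 * (e + e) by ring.
  apply: translate_base_dist; first by lra.
  by rewrite (le_trans (ler_distD (isometry_fun u base_point) _ _))// lerD// ltW// distrC.
have /cvg_ex[a0 Fa0] : cvg F.
  apply/cauchy_cvgP/cauchyP => e e0.
  pose d := Num.min (1 / 4) (e / 8).
  have d0 : 0 < d by rewrite lt_min !divr_gt0.
  have [a [ua _]] := near_u base_point d d0.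
  exists a, d => // b /= ub; rewrite -ball_normE /=.
  have d4 : d <= 1 / 4 by rewrite ge_min lexx.
  have d8 : d <= e / 8 by rewrite ge_min lexx orbT.
  have := close d a b d4 ua ub; lra.
exists a0 => //; apply: isometry_group_ext => v; rewrite translationE.
apply/eqP; rewrite -subr_eq0 -normr_le0; apply/ler_addgt0Pl => e e0; rewrite addr0.
have e2 : 0 < e / 2 by rewrite divr_gt0.
have [d d0 Hd] := translate_uniform v e2.
pose r := Num.min (Num.min (1 / 4) (d / 16)) (e / 2).
have r0 : 0 < r by rewrite !lt_min !divr_gt0.
have r4 : r <= 1 / 4 by rewrite !ge_min lexx.
have rd : r <= d / 16 by rewrite !ge_min lexx !orbT.
have re : r <= e / 2 by rewrite !ge_min lexx orbT.
have [a [ua uva]] := near_u v r r0.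
have aa0 : `|a0 - a| < d.
  have d2 : 0 < d / 2 by rewrite divr_gt0.
  have Fd : F (ball a0 (d / 2)) by apply: Fa0; exact: nbhsx_ballx.
  have Fr : F [set b : X | `|isometry_fun u base_point - translate b base_point| < r].
    by exists r.
  have [b []] := near_ex2 Fd Fr; rewrite -ball_normE /= => a0b ub.
  have ba := close r b a r4 ub ua.
  rewrite (le_lt_trans (ler_distD b _ _))//=; lra.
rewrite (le_trans (ler_distD (translate a v) _ _))// (splitr e) lerD//; first exact: Hd.
by rewrite distrC (le_trans (ltW uva)).
Qed.

Lemma translation_homeomorphism :
  homeomorphism_onto (range (@translation R X)) (@translation R X).
Proof.
have inj := @translation_inj R X.
split.
- by split; [move=> a _; exists a|move=> a b _ _; exact: inj|move=> _ [a _ <-]; exists a].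
- exact: translation_continuous.
pose g u : X := xget 0 [set a | translation a = u].
have gK : cancel (@translation R X) g.
  move=> a; apply: inj.
  exact: (@xgetPex _ 0 [set b | translation b = translation a] (ex_intro _ a erefl)).
exists g => //; apply/subspace_continuousP => _ [a _ <-].
apply/cvgrPdist_lt => e e0.
change (\forall w \near within (range translation) (nbhs (translation a)),
  `|g (translation a) - g w| < e); rewrite gK.
pose r := Num.min (1 / 2) (e / 4).
have r0 : 0 < r by rewrite lt_min !divr_gt0.
have r2 : r <= 1 / 2 by rewrite ge_min lexx.
have re : r <= e / 4 by rewrite ge_min lexx orbT.
rewrite near_withinE; apply: filterS (nbhs_isometry (translation a) base_point r0).
move=> w + [b _ wb]; rewrite -wb gK /= !translationE => /ltW/(translate_base_dist r2).
by move=> /le_lt_trans; apply; lra.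
Qed.

End ClosedOrbit.

Theorem mainTheorem1 (R : realType) (X : completeNormedModType R)
    (sepX : separable_space X) (stabX : stable_space X) :
  exists (E : completeNormedModType R) (T : X -> isometry_group E)
         (G : set (isometry_group E)),
    [/\ separable_space E,
        reflexive_space E,
        group_closed (mem G),
        closed G &
        [/\ set_bij [set: X] G T,
            forall x y : X, T (x + y) = (T x * T y)%g,
            forall x : X, (T x)^-1%g = T (- x) &
            homeomorphism_onto G T]].
Proof.
exists (dfjp_space (@norm_kernel R X)), (@translation R X), (range (@translation R X)).
have ksep := ker_separable sepX.
have ksep' : kernel_separable (fun t s : X => ker s t).
  by under eq_fun do under eq_fun do rewrite kerC.
have [bij cont inv] := @translation_homeomorphism R X.
split.
- exact: dfjp_separable.
- apply: dfjp_reflexive => C D; apply: double_limits_fmeas => //.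
    exact: ker_bounded.
  exact: stable_double_limits.
- split; first by apply/mem_set; exists 0 => //; exact: translation0.
  move=> _ _ /set_mem[a _ <-] /set_mem[b _ <-]; apply/mem_set; exists (a - b) => //.
  by rewrite translationD translationV.
- exact: closed_translations.
split => //.
- exact: translationD.
- exact: translationV.
Qed.
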